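(* Let $g_1=(1,0)$, $g_2=(1/2,\sqrt{3}/2)$, let $\Lambda=\{mg_1+ng_2: m,n\in\mathbb{Z}\}$, and let $\Lambda_U$ be the undirected Cayley graph with vertex set $\Lambda$ and symmetric generating set $U=\{\pm g_1,\ \pm(g_1+g_2),\ \pm g_2,\ \pm(2g_2-g_1),\ \pm(g_2-g_1),\ \pm(g_2-2g_1)\}$. Then for every $n\geq 3$, the maximum number of edges of a subgraph of $\Lambda_U$ with $n$ vertices is $$e(n)=\begin{cases}6n-4\sqrt{6n-6} & \text{if } n=24k^2-24k+7 \text{ for some } k\in\mathbb{N},\\ \lfloor 6n-\sqrt{96n-63}\rfloor & \text{otherwise.}\end{cases}$$ Additionally, the edge isoperimetric problem of $\Lambda_U$ has nested solutions, that is, there is an ordering $v_1,v_2,\dots$ of all the elements of $\Lambda$ such that for each $n\geq 1$, the set $\{v_1,\dots,v_n\}$ minimizes $\partial(S)$ among all subsets $S\subseteq\Lambda$ with $|S|=n$.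
   Context: In $\Lambda_U$, two vertices $x,y\in\Lambda$ are joined by an edge if and only if $y-x\in U$ (equivalently, their Euclidean distance is $1$ or $\sqrt{3}$). For $S\subseteq\Lambda$, the edge boundary is the number $\partial(S)=|\{uv\in E(\Lambda_U): u\in S,\ v\notin S\}|$. $\mathbb{N}=\{1,2,3,\dots\}$. *)

(* Defs.v *)
From mathcomp Require Import all_boot all_order all_algebra.
From mathcomp Require Import finmap.
From mathcomp Require Import mathcomp_extra boolp classical_sets functions.
From mathcomp Require Import cardinality reals.

Set Implicit Arguments.
Unset Strict Implicit.
Unset Printing Implicit Defensive.

Import Order.TTheory GRing.Theory Num.Theory.

Local Open Scope classical_set_scope.
Local Open Scope ring_scope.

Notation plane R := (R * R)%type (only parsing).

Definition g1 (R : realType) : plane R := (1, 0).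

Definition g2 (R : realType) : plane R := (1 / 2, Num.sqrt 3 / 2).

Definition Lambda (R : realType) : set (plane R) :=
  [set x | exists m n : int, x = g1 R *~ m + g2 R *~ n].

Arguments Lambda : clear implicits.

Definition U (R : realType) : seq (plane R) :=
  let a := g1 R in let b := g2 R in
  [:: a; - a; a + b; - (a + b); b; - b;
      b *+ 2 - a; - (b *+ 2 - a); b - a; - (b - a);
      b - a *+ 2; - (b - a *+ 2)].

(* An undirected edge is the two-element set of its endpoints. *)
Definition Lambda_U_edges (R : realType) : set {fset plane R} :=
  [set e | exists x y : plane R,
     [/\ Lambda R x, Lambda R y, y - x \in U R & e = [fset x; y]%fset]].

Arguments Lambda_U_edges : clear implicits.

Definition is_subgraph (R : realType)
    (V : {fset plane R}) (E : {fset {fset plane R}}) : Prop :=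
  [/\ [set` V] `<=` Lambda R,
      [set` E] `<=` Lambda_U_edges R &
      forall e, e \in E -> (e `<=` V)%fset].

Definition edge_boundary (R : realType) (S : {fset plane R}) :
    set {fset plane R} :=
  [set e | Lambda_U_edges R e /\
     exists u v : plane R, [/\ e = [fset u; v]%fset, u \in S & v \notin S]].

Lemma finite_edge_boundary (R : realType) (S : {fset plane R}) :
  finite_set (edge_boundary S).
Proof.
have finT : finite_set ([set` S] `*` [set` U R]).
  by apply: finite_setX => //; exact: finite_seq.
have finI := finite_image _ finT.
pose f (p : plane R * plane R) := let: (x, d) := p in [fset x; (x + d)%R]%fset.
pose g (p : plane R * plane R) := let: (x, d) := p in [fset x; (x - d)%R]%fset.
apply: (sub_finite_set _ (_ : finite_set (
    f @` ([set` S] `*` [set` U R]) `|` g @` ([set` S] `*` [set` U R]))));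
  last by rewrite finite_setU; split; exact: finI.
move=> _ [[x [y [_ _ xyU ->]]] [u [v [exy uS _]]]].
have : u \in [fset x; y]%fset by rewrite exy !inE eqxx.
rewrite !inE => /orP[] /eqP uE; subst u.
- left; exists (x, y - x) => //=.
  by rewrite addrC subrK.
- right; exists (y, y - x) => //=.
  by rewrite opprB addrC subrK fsetUC.
Qed.

(* [fset_set] is the empty set on infinite sets; [finite_edge_boundary] shows
   that this case does not arise. *)
Definition boundary_size (R : realType) (S : {fset plane R}) : nat :=
  #|` fset_set (edge_boundary S)|.

(* Stated in [int], so that the subtraction is not truncated. *)
Definition is_exceptional (n : nat) : Prop :=
  exists2 k : nat, (1 <= k)%N &
    n%:Z = 24 * k%:Z ^+ 2 - 24 * k%:Z + 7.

Definition max_edges (R : realType) (n : nat) : R :=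
  if `[< is_exceptional n >] then
    6 * n%:R - 4 * Num.sqrt (6 * n%:R - 6)
  else (Num.floor (6 * n%:R - Num.sqrt (96 * n%:R - 63) : R))%:~R.

(* [v] is indexed from 0: the initial segment of length n is
   v 0, ..., v (n - 1). *)
Definition initial_segment (R : realType) (v : nat -> plane R) (n : nat) :
    {fset plane R} := [fset v i | i in iota 0 n]%fset.

(* The minimum is over the finite subsets of Lambda of cardinality n. *)
Definition minimizes_boundary (R : realType) (n : nat) (A : {fset plane R}) :
    Prop :=
  [/\ [set` A] `<=` Lambda R, #|` A| = n &
      forall S : {fset plane R}, [set` S] `<=` Lambda R ->
        #|` S| = n -> (boundary_size A <= boundary_size S)%N].

(* Main.v *)
Require Import Defs.
From mathcomp Require Import all_boot all_order all_algebra.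
From mathcomp Require Import finmap.
From mathcomp Require Import mathcomp_extra boolp classical_sets functions.
From mathcomp Require Import cardinality reals.
From mathcomp Require Import zify ring lra.

(* With B = 6n - e, where e counts the edges induced by n points, one has to
   minimize B.  Let r_1, ..., r_h be the sizes of the rows of the set in
   direction g_1.  The edges inside rows, between consecutive rows and between
   rows at distance two are most numerous when the rows are centred intervals,
   which bounds e by an explicit function of (r_i).  Comparing the r_i with the
   unimodal profile given by the running maxima towards a largest row M, and
   counting by z_j the steps at which this profile rises by more than j, one
   bounds n above and B below by a quadratic and a linear polynomial in
   h, M, z_0, z_1, z_2.  Then B^2 - 96 n is, up to a bounded term, a sum of
   squares, and parity decides the constant.
   Conversely, twelve-gons whose sides are added one at a time in a suitable
   periodic order are optimal at every moment: when a side is added, its first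
   point has five neighbours in the set, and each later one has six. *)

Set Implicit Arguments.
Unset Strict Implicit.
Unset Printing Implicit Defensive.

Import Order.TTheory GRing.Theory Num.Theory.

(** * Row profiles *)

(** Two kinds of profile escape the estimate: those with two adjacent rows of size 1, where the flat
    bound on [pmax] fails, and those whose largest rows at even and at odd positions differ by two
    or more. Apart from one small profile, both are removed by induction on the number of points: a
    row is deleted or shortened, and the edges lost are no more than the formula allows for one
    point. In the other profiles the two maxima are equal or differ by one, and only the second case
    produces exceptional n: if 96 n exceeds B^2 + 63 there, all four squares vanish, whence n = 6
    Y^2 + 1 and B = 24 Y with Y odd. In the construction a layer raises B by at most one, whatever
    its length. Round k starts from the exceptional number 24 k^2 - 24 k + 7 with B at most 48 k -
    24, and its 48 layers, 48 k points in all, lead to the next one. *)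

(* The largest number of edges between two consecutive rows of sizes [r] and
   [s]: a pair of points, at abscissas [a] and [b], is an edge iff
   [-2 <= b - a <= 1]. *)
Fixpoint pmax (r s : nat) : nat :=
  match r, s with
  | r'.+1, s'.+1 => minn (r * s) (pmax r' s' + 4)
  | _, _ => 0
  end.

Lemma pmax0 r : pmax r 0 = 0.
Proof. by case: r. Qed.

Lemma pmaxC r s : pmax r s = pmax s r.
Proof. by elim: r s => [|r IH] [|s] //=; rewrite IH mulnC. Qed.

Lemma pmaxS r s :
  pmax r.+1 s.+1 = minn (r.+1 * s.+1) (pmax r s + 4).
Proof. by []. Qed.

Lemma pmax_ge r s : minn r s <= pmax r s.
Proof.
elim: r s => [|r IH] [|s] //=; have := IH s.
by case: r {IH} => [|r]; [|case: s => [|s]]; nia.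
Qed.

Lemma pmax_le4 r s : pmax r s <= 4 * s.
Proof. by elim: r s => [|r IH] [|s] //=; have := IH s; lia. Qed.

Lemma pmax_le_diff r s : 0 < s -> s <= r -> pmax r s + 3 <= 3 * s + r.
Proof.
elim: r s => [|r IH] [|s] //= _ sr.
have [s0|s0] := posnP s; first by subst s; lia.
by have := IH s s0 sr; lia.
Qed.

(** Exact when the sizes differ by at most 1, as [pmax_le_diff] is for differences 1 to 3 and
    [pmax_le4] from 3 on. At (1, 1) the product 1 exceeds the bound 0. *)
Lemma pmax_le_flat r s : 0 < r -> 0 < s -> (r, s) != (1, 1) ->
  pmax r s + 4 <= 2 * (r + s).
Proof.
elim: r s => [|r IH] [|s] //= _ _ rs1.
have [s0|s0] := posnP s; first by subst s; case: r rs1 {IH} => //= r _; lia.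
have [r0|r0] := posnP r; first by subst r; case: s rs1 s0 {IH} => //= s _; lia.
have [/eqP[-> ->] //|rs] := boolP ((r, s) == (1, 1)).
by have := IH s r0 s0 rs; lia.
Qed.

Lemma pmax_eq s d : 0 < s -> 0 < d ->
  pmax (s + d) s = 4 * s - (if d == 1 then 2 else if d == 2 then 1 else 0).
Proof.
elim: s => // s IH _ d0; rewrite addSn pmaxS.
have [->|s0] := posnP s; first by rewrite pmax0 {IH}; case: d d0 => [|[|[|d]]] //= _; lia.
rewrite IH // {IH}; case: d d0 => [|[|[|d]]] //= _; nia.
Qed.

Lemma pmax_decr r s : s + 2 <= r -> pmax r s <= pmax r.-1 s + (0 < s).
Proof.
case: (posnP s) => [->|s0 sr]; first by rewrite !pmax0.
have -> : r = s + (r - s) by lia.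
have -> : (s + (r - s)).-1 = s + (r - s).-1 by lia.
rewrite !pmax_eq //; try lia.
have [d ->] : exists d, r - s = d.+2 by exists (r - s - 2); lia.
by case: d => [|[|d]] /=; lia.
Qed.

Fixpoint adjacent_pairs (s : seq nat) : nat :=
  if s is r :: s' then pmax r (head 0 s') + adjacent_pairs s' else 0.

Fixpoint skip_pairs (s : seq nat) : nat :=
  if s is r :: s' then minn r (nth 0 s' 1) + skip_pairs s' else 0.

Definition row_edges (s : seq nat) : nat :=
  \sum_(r <- s) r.-1 + adjacent_pairs s + skip_pairs s.

Lemma row_edges_cons r s : row_edges (r :: s) =
  row_edges s + (r.-1 + pmax r (head 0 s) + minn r (nth 0 s 1)).
Proof. rewrite /row_edges big_cons /=; lia. Qed.

Lemma row_edges_nil : row_edges [::] = 0.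
Proof. by rewrite /row_edges big_nil. Qed.

(** Deleting an empty row makes its two neighbours adjacent, and [pmax] is at least [minn]. *)
Lemma row_edges_filter s : row_edges s <= row_edges [seq r <- s | 0 < r].
Proof.
(* One or two rows are put in front because [row_edges] looks two rows ahead. *)
suff H : row_edges s <= row_edges [seq r <- s | 0 < r] /\
    (forall r, row_edges (r :: s) <= row_edges (r :: [seq r <- s | 0 < r])) /\
    (forall q r, row_edges (q :: r :: s) <=
                 row_edges (q :: r :: [seq r <- s | 0 < r])).
  by have [] := H.
elim: s => [|x s [IH0 [IH1 IH2]]] //=.
have [x0|x0] := posnP x; last first.
  split; first exact: IH1.
  split=> [r|q r]; first exact: IH2.
  by rewrite !(row_edges_cons q) leq_add2r; apply: IH2.
subst x => /=.
have E0 u : row_edges (0 :: u) = row_edges u.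
  by rewrite row_edges_cons /= min0n !addn0.
split; first by rewrite E0.
split=> [r|q r].
  apply: leq_trans (IH1 r).
  rewrite !row_edges_cons /= pmax0 min0n /= !addn0 nth0.
  by have := pmax_ge r (head 0 s); lia.
apply: leq_trans (IH2 q r).
rewrite !row_edges_cons /= pmax0 min0n minn0 /= !addn0 !nth0.
by have := pmax_ge r (head 0 s); lia.
Qed.

(** This disposes of the pair (1, 1) excluded in [pmax_le_flat]: the induction on n can afford to
    lose three edges with a point. *)
Lemma row_edges_dup1 s t : all (leq 1) s ->
  row_edges (s ++ 1 :: 1 :: t) <= row_edges (s ++ 1 :: t) + 2.
Proof.
elim: s => [|a s IH] /=.
  by move=> _; rewrite !row_edges_cons /= nth0; lia.
case/andP=> a0 s0; have {IH} := IH s0.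
case: s s0 => [|b s] _.
  by rewrite /= !row_edges_cons /= nth0; lia.
by case: s => [|c s]; rewrite !cat_cons ?cat0s (row_edges_cons a) (row_edges_cons a _) /=; lia.
Qed.

Lemma row_edges_prefix s b c t u :
  row_edges (s ++ b :: c :: t) + row_edges (b :: c :: u) =
  row_edges (s ++ b :: c :: u) + row_edges (b :: c :: t).
Proof.
elim: s => [|a s IH] /=; first by rewrite addnC.
rewrite !(row_edges_cons a).
have -> : head 0 (s ++ b :: c :: t) = head 0 (s ++ b :: c :: u) by case: s {IH}.
have -> : nth 0 (s ++ b :: c :: t) 1 = nth 0 (s ++ b :: c :: u) 1.
  by case: s {IH} => [|? []].
lia.
Qed.

Lemma row_edges_decr0 M t : head 0 t + 2 <= M -> nth 0 t 1 < M ->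
  row_edges (M :: t) <= row_edges (M.-1 :: t) + 1 + (0 < head 0 t).
Proof.
move=> tM tM1; rewrite !row_edges_cons.
have := pmax_decr tM; lia.
Qed.

Lemma row_edges_decr1 c M t : c + 2 <= M ->
  head 0 t + 2 <= M -> nth 0 t 1 < M ->
  row_edges (c :: M :: t) <= row_edges (c :: M.-1 :: t) + 2 + (0 < head 0 t).
Proof.
move=> cM tM tM1; have := row_edges_decr0 tM tM1.
rewrite !(row_edges_cons c) /= !(pmaxC c).
have := pmax_decr cM; lia.
Qed.

(** Shortening the row [M] loses one edge inside it, at most one to each adjacent row by
    [pmax_decr], and one to the row [b] only if [b] is at least as long; the row two places after it
    is shorter than [M] and loses none. *)
Lemma row_edges_decr2 s b c M t : c + 2 <= M ->
  head 0 t + 2 <= M -> nth 0 t 1 < M ->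
  row_edges (s ++ b :: c :: M :: t) <=
  row_edges (s ++ b :: c :: M.-1 :: t) + 2 + (0 < head 0 t) + (M <= b).
Proof.
move=> cM tM tM1; have := row_edges_decr1 cM tM tM1.
have := row_edges_prefix s b c (M :: t) (M.-1 :: t).
rewrite !(row_edges_cons b) /=; lia.
Qed.

Fixpoint parity_maxima (s : seq nat) : nat * nat :=
  if s is r :: s' then
    (maxn r (parity_maxima s').2, (parity_maxima s').1)
  else (0, 0).

Lemma nth0_parity_maxima s :
  (nth 0 s 0 <= (parity_maxima s).1) && (nth 0 s 1 <= (parity_maxima s).2).
Proof. by case: s => [|a [|b s]] //=; lia. Qed.

(** Rows at distance two form two chains, one for each parity of the position. In a chain, each
    consecutive pair is charged to its member farther from a largest row, and that row is never
    charged. *)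
Lemma skip_pairs_le s :
  skip_pairs s + (parity_maxima s).1 + (parity_maxima s).2 <= sumn s.
Proof. by elim: s => //= r s IH; have := nth0_parity_maxima s; lia. Qed.

Lemma parity_maxima_adjacent s x y t (p := parity_maxima (s ++ x :: y :: t)) :
  (x <= p.1) && (y <= p.2) || (x <= p.2) && (y <= p.1).
Proof. by rewrite {}/p; elim: s => [|a s IH] /=; lia. Qed.

Lemma parity_maxima_mem s : s != [::] ->
  maxn (parity_maxima s).1 (parity_maxima s).2 \in s.
Proof.
elim: s => // a s IH _; have [->|/IH {IH}] := eqVneq s [::].
  by rewrite /= !maxn0 mem_head.
have -> : parity_maxima (a :: s) =
  (maxn a (parity_maxima s).2, (parity_maxima s).1) by [].
case: (parity_maxima s) => p q /= pq; rewrite inE.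
have [apq|pqa] := leqP a (maxn p q).
  by have -> : maxn (maxn a q) p = maxn p q by [lia]; rewrite pq orbT.
by have -> : maxn (maxn a q) p = a by [lia]; rewrite eqxx.
Qed.

Lemma parity_maxima_ge s x : x \in s ->
  x <= maxn (parity_maxima s).1 (parity_maxima s).2.
Proof. by elim: s => //= a s IH; rewrite inE => /orP[/eqP ->|/IH]; lia. Qed.

Definition not_both (v : nat) : rel nat := fun x y => ~~ ((x == v) && (y == v)).

(* [s] lists rows met when walking outwards from the row [c]; [z0], [z1], [z2]
   count the steps at which the running maximum, taken inwards, increases by
   at least 1, 2 and 3. *)
Lemma outward_profile (b : bool) M c s :
    all (leq 1) (c :: s) -> all (geq M) (c :: s) -> path (not_both 1) c s ->
    (b -> path (not_both M) c s) ->
  exists z0 z1 z2 m, [/\ all (geq m) (c :: s), m <= M,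
    [&& z0 <= size s, z1 <= size s & z2 <= size s],
    2 * m + 4 * size s + adjacent_pairs (c :: s) <=
      4 * sumn s + 2 * c + 2 * z0 + z1 + z2 &
    2 * sumn (c :: s) + z0 * z0.+1 + z1 * z1.+1 + z2 * z2.+1 +
      (if b && (m == M) then (size s - z0) + (c != M) else 0) <=
    2 * (size s).+1 * m].
Proof.
elim: s c => [|d s IH] c.
  move=> /= /andP[c0 _] /andP[cM _] _ _.
  exists 0, 0, 0, c; rewrite leqnn; split=> //; first by rewrite pmax0; lia.
  by case: (c == M); rewrite ?andbT ?andbF; case: b; rewrite /=; lia.
move=> /= /and3P[c0 d0 s0] /and3P[cM dM sM] /andP[cd1 ps1] psM.
have [||||z0 [z1 [z2 [m [/= /andP[dm sm] mM /and3P[z0s z1s z2s] cost defect]]]]] := IH d.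
- by rewrite /= d0.
- by rewrite /= dM.
- exact: ps1.
- by move=> hb; have /andP[] := psM hb.
clear IH.
have cd1' : (c, d) != (1, 1) by rewrite xpair_eqE.
have F := pmax_le_flat c0 d0 cd1'.
set a := pmax d _ + _ in cost *.
(* If the running maximum stays, the flat bound [F] pays for the step. If it rises by 1, 2 or at
   least 3, then [F], [Pd] and [P4] respectively leave 2, 3 or 4 units unpaid, which is the growth
   of 2 z0 + z1 + z2. *)
have [cm|mc] := leqP c m.
  exists z0, z1, z2, m; split=> //.
  - by rewrite /= cm dm sm.
  - by clear -z0s z1s z2s; rewrite /=; lia.
  - by clear -cost F; rewrite /= -/a; lia.
  clear -defect cm mM psM z0s; move: defect; case: eqP => mMe; rewrite ?andbT ?andbF; last by lia.
  case: b psM => [/(_ isT) /andP[+ _]|_]; last by clear -cm; lia.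
  (* As [c] and [d] are not both [M], the shortfall 2 (M - c), together with the credit for [d],
     covers the additional flat step. *)
  by rewrite /not_both; case: eqP => ?; case: eqP => ? //= _; nia.
have cmall : all (geq c) s by apply: sub_all sm => x /= xm; apply: leq_trans (ltnW mc).
have dc : d <= c by apply: leq_trans (ltnW mc).
have P4 := pmax_le4 c d.
have Pd : pmax c d + 3 <= 3 * d + c by apply: pmax_le_diff.
have /negbTE mM' : m != M by clear -mc cM; lia.
move: defect; rewrite mM' andbF addn0 => defect.
have X : (if b && (c == M) then (size s).+1 - z0.+1 + (c != M) else 0) <= size s - z0.
  by rewrite subSS; case: (c == M); rewrite ?andbT ?andbF ?addn0 //; case: b {psM defect}.
(* When the maximum rises to [c], each of the [(size s).+1] outer rows falls short by [c - m] more;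
   this feeds one new term of each triangular sum that grows. *)
have D1 : 2 * (size s).+2 * c = 2 * (size s).+1 * m + 2 * c + 2 * ((size s).+1 * (c - m)).
  by clear -mc; nia.
have [c1|] := eqVneq c m.+1.
  exists z0.+1, z1, z2, c; split=> //.
  - by rewrite /= leqnn cmall andbT.
  - by clear -z0s z1s z2s; rewrite /=; lia.
  - by clear -cost F dm c1; rewrite /= -/a; lia.
  have e1 : c - m = 1 by clear -c1; lia.
  move: X; rewrite D1 e1; move: (if _ then _ else _) => X XE.
  by clear -XE defect z0s c1; rewrite /=; nia.
have [c2 _|c2 c1] := eqVneq c m.+2.
  exists z0.+1, z1.+1, z2, c; split=> //.
  - by rewrite /= leqnn cmall andbT.
  - by clear -z0s z1s z2s; rewrite /=; lia.
  - by clear -cost Pd dm c2; rewrite /= -/a; lia.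
  have e1 : c - m = 2 by clear -c2; lia.
  move: X; rewrite D1 e1; move: (if _ then _ else _) => X XE.
  by clear -XE defect z0s z1s c2; rewrite /=; nia.
exists z0.+1, z1.+1, z2.+1, c; split=> //.
- by rewrite /= leqnn cmall andbT.
- by clear -z0s z1s z2s; rewrite /=; lia.
- by clear -cost P4 dm c1 c2 mc; rewrite /= -/a; lia.
have e1 : 3 * (size s).+1 <= (size s).+1 * (c - m) by clear -c1 c2 mc; nia.
move: X; rewrite D1; move: (if _ then _ else _) => X XE.
by clear -XE defect z0s z1s z2s e1; rewrite /=; nia.
Qed.

(** * Quadratic optimization *)

Section Arith.
Local Open Scope ring_scope.
Local Open Scope int_scope.

Lemma sq_ge0 (x : int) : 0 <= x * x.
Proof. by rewrite -expr2 sqr_ge0. Qed.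

Lemma sq_ge1 (x : int) : x != 0 -> 1 <= x * x.
Proof. by move=> x0; have := sq_ge0 x; have : x * x != 0; [rewrite mulf_neq0 | lia]. Qed.

Lemma sq_le3 (x : int) : x * x <= 3 -> -1 <= x <= 1.
Proof. by move=> x3; apply/andP; split; rewrite leNgt; apply/negP => x2; nia. Qed.

(** Excludes 96 n = B^2 + 64: in the extreme cases the squares and the parities alone only give the
    constant 64. *)
Lemma sq_neq2_mod3 (B m : int) : B * B <> 3 * m + 2.
Proof.
have Bq : B = (B %/ 3)%Z * 3 + (B %% 3)%Z by apply: divz_eq.
have : (B %% 3)%Z = 0 \/ (B %% 3)%Z = 1 \/ (B %% 3)%Z = 2 by lia.
move: (B %/ 3)%Z (B %% 3)%Z Bq => q r Bq.
by case=> [|[|]] rE; rewrite Bq rE; lia.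
Qed.

(** The squares vanish at the proportions of the optimal twelve-gon: h = B / 8, M = 5 B / 48, W = B
    / 12 and Y = Z = B / 24. *)
Lemma flat_identity (h M W Y Z B : int) :
  B = 5 * h + 6 * M - 2 * W - Y - Z ->
  B * B + 24 * (W * W + Y * Y + Z * Z) =
  96 * (h * M) + 4 * ((3 * h + 6 * M - B) * (3 * h + 6 * M - B)) +
  (8 * h - B) * (8 * h - B) + 12 * ((Y - Z) * (Y - Z)) +
  8 * ((W - Y - Z) * (W - Y - Z)).
Proof. by move=> ->; ring. Qed.

(** The constant is 24 e, at most 48 unless e = 3. In that case W - Y - Z is odd, so the last square
    brings 72 down to 64, and 64 is impossible modulo 3. *)
Lemma flat_top_bound (h M W Y Z n B e : int) :
  B = 5 * h + 6 * M - 2 * W - Y - Z ->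
  4 * n + W * W + Y * Y + Z * Z <= 4 * (h * M) + e ->
  e <= 3 -> (e = 3 -> exists t, W - Y - Z = 2 * t + 1) ->
  96 * n <= B * B + 63.
Proof.
move=> BE nle e3 odd.
have id := flat_identity BE.
have := sq_ge0 (3 * h + 6 * M - B); have := sq_ge0 (8 * h - B).
have := sq_ge0 (Y - Z); have := sq_ge0 (W - Y - Z).
move: (_ * (W - Y - Z)) (_ * (Y - Z)) (_ * (8 * h - B)) (_ * (3 * h + 6 * M - B))
  (sq_ge1 (x := W - Y - Z)) id => s1 s2 s3 s4 s1_1 id s1_0 s2_0 s3_0 s4_0.
move: (W * W) (Y * Y) (Z * Z) (h * M) id nle => w y z hM id nle.
have BB := @sq_neq2_mod3 B (32 * n - 22).
move: (B * B) id BB => b id BB.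
have [e3'|e2] := eqVneq e 3; last by lia.
have [t tE] := odd e3'; have : 1 <= s1 by apply: s1_1; rewrite tE; lia.
lia.
Qed.

(* Here the largest rows alternate between [M] and [M - 1], [P = 2 M - 1], and
   [W] is one less than in [flat_identity]. *)
Lemma zigzag_identity (h P W Y Z B : int) :
  B = 5 * h + 3 * P - 2 * W - Y - Z ->
  B * B + 24 * (W * W + Y * Y + Z * Z) =
  48 * (h * P) + 4 * ((3 * h + 3 * P - B) * (3 * h + 3 * P - B)) +
  (8 * h - B) * (8 * h - B) + 12 * ((Y - Z) * (Y - Z)) +
  8 * ((W - Y - Z) * (W - Y - Z)).
Proof. by move=> ->; ring. Qed.

Lemma zigzag_exceptional (h P Y n B p y : int) :
  B = 5 * h + 3 * P - 6 * Y -> P = 2 * p + 1 -> Y = 2 * y + 1 ->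
  96 * n + 4 * ((3 * h + 3 * P - B) * (3 * h + 3 * P - B)) +
    (8 * h - B) * (8 * h - B) <= B * B + 96 ->
  B * B + 63 < 96 * n ->
  n = 6 * (Y * Y) + 1 /\ B = 24 * Y.
Proof.
move=> BE PE YE le lt.
(* The two squares become 16 a^2 and 9 c^2 with sum at most 32, so a and c lie in {-1, 0, 1}; as P
   and Y are odd, they have the same parity. If both are nonzero, B^2 is 73 modulo 96 and no
   multiple of 96 lies between B^2 + 64 and B^2 + 71. *)
pose a := h - 3 * Y; pose c := h - P + 2 * Y.
have u2 : 4 * ((3 * h + 3 * P - B) * (3 * h + 3 * P - B)) = 16 * (a * a).
  by rewrite BE /a; ring.
have v2 : (8 * h - B) * (8 * h - B) = 9 * (c * c) by rewrite BE /c; ring.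
have hE : h = 3 * Y + a by rewrite /a; lia.
have PE2 : P = 5 * Y + a - c by rewrite /c /a; lia.
have BE2 : B = 24 * Y + (8 * a - 3 * c) by lia.
rewrite u2 v2 in le.
have a0 := sq_ge0 a; have c0 := sq_ge0 c.
have aB : -1 <= a <= 1 by apply: sq_le3; lia.
have cB : -1 <= c <= 1 by apply: sq_le3; lia.
have BB : B * B = 576 * (Y * Y) + 48 * (Y * (8 * a - 3 * c)) +
   (8 * a - 3 * c) * (8 * a - 3 * c) by rewrite BE2; ring.
move: a c {hE u2 v2} aB cB a0 c0 PE2 BE2 BB le => a c aB cB a0 c0 PE2 BE2 BB le.
rewrite BB in le lt; move: (Y * Y) le lt {BB} => YY.
have : a = -1 \/ a = 0 \/ a = 1 by lia.
have : c = -1 \/ c = 0 \/ c = 1 by lia.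
by case=> [|[|]] cE [|[|]] aE; rewrite cE aE; rewrite cE aE in BE2 PE2; lia.
Qed.

(** The constant is 24 (1 + e0 + e1 + e2) minus the squares. By parity it is at most 64 unless Y =
    Z, W = 2 Y and e0 = e1 = e2 = 1; the value 64 is impossible modulo 3. *)
Lemma zigzag_bound (h P W Y Z n B e0 e1 e2 p w y z : int) :
  B = 5 * h + 3 * P - 2 * W - Y - Z ->
  4 * n + W * W + Y * Y + Z * Z <= 2 * (h * P) + 1 + e0 + e1 + e2 ->
  P = 2 * p + 1 -> W = 2 * w + 1 - e0 -> Y = 2 * y + e1 -> Z = 2 * z + e2 ->
  0 <= e0 <= 1 -> 0 <= e1 <= 1 -> 0 <= e2 <= 1 ->
  96 * n <= B * B + 63 \/
  [/\ n = 6 * (Y * Y) + 1, B = 24 * Y & Y = 2 * y + 1].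
Proof.
move=> BE nle PE WE YE ZE e0b e1b e2b.
have id := zigzag_identity BE.
have s1 := sq_ge0 (3 * h + 3 * P - B); have s2 := sq_ge0 (8 * h - B).
have s3 := sq_ge0 (Y - Z); have s4 := sq_ge0 (W - Y - Z).
have s3' := @sq_ge1 (Y - Z); have s4' := @sq_ge1 (W - Y - Z).
have le : 96 * n + 4 * ((3 * h + 3 * P - B) * (3 * h + 3 * P - B)) +
  (8 * h - B) * (8 * h - B) + 12 * ((Y - Z) * (Y - Z)) +
  8 * ((W - Y - Z) * (W - Y - Z)) <= B * B + 24 + 24 * (e0 + e1 + e2).
  clear -nle id; move: (_ * (W - Y - Z)) (_ * (Y - Z)) (_ * (8 * h - B))
    (_ * (3 * h + 3 * P - B)) id => u1 u2 u3 u4 id.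
  lia.
have [ok|gt] := leP (96 * n) (B * B + 63); first by left.
right.
have YZ : Y = Z.
  have [/eqP|YZ] := eqVneq (Y - Z) 0; first by rewrite subr_eq0 => /eqP.
  exfalso; have [t|t2] : (Y - Z = 2 * (y - z)) \/ (e1 + e2 <= 1) by lia.
    have : 1 <= (y - z) * (y - z) by apply: sq_ge1; lia.
    have : (Y - Z) * (Y - Z) = 4 * ((y - z) * (y - z)) by rewrite t; ring.
    clear -s1 s2 s4 le gt e0b e1b e2b. 
    move: (_ * (W - Y - Z)) (_ * (Y - Z)) (_ * (8 * h - B))
      (_ * (3 * h + 3 * P - B)) (_ * (y - z)) (B * B) s1 s2 s4 le gt => *; lia.
  move: (s3' YZ); clear -s1 s2 s4 le gt e0b e1b e2b t2.
  move: (_ * (W - Y - Z)) (_ * (Y - Z)) (_ * (8 * h - B))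
      (_ * (3 * h + 3 * P - B)) (B * B) s1 s2 s4 le gt => *; lia.
rewrite -!YZ in BE ZE le s3 s4 s3' s4'.
have e12 : e1 = e2 by lia.
have W2Y : W = 2 * Y.
  have [|WY] := eqVneq (W - Y - Y) 0; first by lia.
  exfalso; have [t|t2] : (W - Y - Y = 2 * (w - y - y - e1)) \/ (e0 = 0) by lia.
    have : 1 <= (w - y - y - e1) * (w - y - y - e1) by apply: sq_ge1; lia.
    have : (W - Y - Y) * (W - Y - Y) = 4 * ((w - y - y - e1) * (w - y - y - e1)).
      by rewrite t; ring.
    have BB := @sq_neq2_mod3 B (32 * n - 22).
    clear -s1 s2 s3 le gt e0b e1b e2b e12 BB.
    move: (_ * (W - Y - Y)) (_ * (Y - Y)) (_ * (8 * h - B))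
      (_ * (3 * h + 3 * P - B)) (_ * (w - y - y - e1)) (B * B)
      s1 s2 s3 le gt BB => *; lia.
  have := s4' WY.
  have BB := @sq_neq2_mod3 B (32 * n - 22).
  clear -s1 s2 s3 le gt e0b e1b e2b t2 BB.
  move: (_ * (W - Y - Y)) (_ * (Y - Y)) (_ * (8 * h - B))
      (_ * (3 * h + 3 * P - B)) (B * B) s1 s2 s3 le gt BB => *; lia.
have e01 : e0 + e1 + e2 = 3.
  clear -s1 s2 s3 s4 le gt e0b e1b e2b WE YE ZE e12 W2Y.
  move: (_ * (W - Y - Y)) (_ * (Y - Y)) (_ * (8 * h - B))
      (_ * (3 * h + 3 * P - B)) (B * B) s1 s2 s3 s4 le gt => *; lia.
have YE1 : Y = 2 * y + 1 by lia.
have [||nE BE3] := @zigzag_exceptional h P Y n B p y _ PE YE1 _ gt.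
- by lia.
- clear -s3 s4 le e01.
  by move: (_ * (W - Y - Y)) (_ * (Y - Y)) (_ * (8 * h - B))
      (_ * (3 * h + 3 * P - B)) (B * B) s3 s4 le => *; lia.
- by [].
Qed.

End Arith.

Definition exceptional (n : nat) : Prop :=
  exists2 k, 1 <= k & n + 24 * k = 24 * k ^ 2 + 7.

(* The values [B = 6 n - e] that the formula of the theorem allows. *)
Definition admissible (n B : nat) : Prop :=
  96 * n <= B ^ 2 + 63 \/ exceptional n /\ 96 * n <= B ^ 2 + 96.

Lemma admissible_leq n B C : B <= C -> admissible n B -> admissible n C.
Proof.
move=> BC; have : B ^ 2 <= C ^ 2 by rewrite leq_sqr.
by move=> BC2 [?|[? ?]]; [left|right; split=> //]; lia.
Qed.

(** Without the parity term the right side exceeds the left by (a - b)^2 - 1, negative only for a =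
    b, where a + b + 1 is odd. *)
Lemma sum_sq_bound a b :
  (a + b).+1 * (a + b).+1 <= 2 * (a * a.+1 + b * b.+1) + odd (a + b).+1.
Proof.
wlog ab : a b / a <= b.
  by move=> H; case: (leqP a b) => [/H //|/ltnW /H]; rewrite [b + a]addnC => ?; lia.
have [d dE] : exists d, b = a + d by exists (b - a); lia.
case: (posnP d) => d0.
  by have -> : odd (a + b).+1 by [lia]; nia.
case: (odd _); nia.
Qed.

Lemma profile_admissible (b : bool) h M (z0 z1 z2 n B : nat) :
  z0 < h -> z1 < h -> z2 < h -> 0 < M ->
  4 * n + z0.+1 * z0.+1 + z1.+1 * z1.+1 + z2.+1 * z2.+1 + 2 * b * (h - z0.+1) <=
    4 * (h * M) + odd z0.+1 + odd z1.+1 + odd z2.+1 ->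
  5 * h + 6 * M <= B + b + 2 * z0.+1 + z1.+1 + z2.+1 ->
  admissible n B.
Proof.
move=> z0h z1h z2h M0 nle Ble.
(* The identities need an exact value of B, so it is lowered to the equality case; admissibility
   passes to larger values. *)
have [C CB CE] : exists2 C, C <= B & C + b + 2 * z0.+1 + z1.+1 + z2.+1 = 5 * h + 6 * M.
  by exists (5 * h + 6 * M - b - 2 * z0.+1 - z1.+1 - z2.+1); case: b {nle} Ble => /=; lia.
apply: admissible_leq CB _; move: z0.+1 z1.+1 z2.+1 z0h z1h z2h CE nle => W Y Z.
clear => Wh Yh Zh CE nle.
have oE k : exists t, k = 2 * t + odd k.
  by exists k./2; rewrite mul2n addnC odd_double_half.
have [w WE] := oE W; have [y YE] := oE Y; have [z ZE] := oE Z.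
rewrite /admissible -mulnn.
case: b CE nle => /= CE nle.
  (* The extra term 2 (h - W) turns W^2 into (W - 1)^2 - 1 and 4 h M into 2 h (2 M - 1). *)
  have [|||||||||H|[H1 H2 H3]] := @zigzag_bound h%:Z (2 * M%:Z - 1)%R (W%:Z - 1)%R Y%:Z Z%:Z n%:Z C%:Z
   (odd W)%:Z (odd Y)%:Z (odd Z)%:Z (M%:Z - 1)%R (w%:Z - 1 + (odd W)%:Z)%R y%:Z z%:Z.
  all: try by clear -CE nle WE YE ZE; lia.
    by left; lia.
  right; split; last by lia.
  (* Here Y = 2 y + 1 = 2 k - 1, and 6 (2 k - 1)^2 + 1 = 24 k^2 - 24 k + 7. *)
  exists y.+1 => //; rewrite -mulnn; nia.
left.
have := @flat_top_bound h%:Z M%:Z W%:Z Y%:Z Z%:Z n%:Z C%:Z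
   (odd W + odd Y + odd Z)%:Z.
case=> //; try lia.
move=> o3; exists (w%:Z - y%:Z - z%:Z - 1)%R; lia.
Qed.

(** * Balanced profiles, split at a largest row *)

Lemma adjacent_pairs_cat s x t : adjacent_pairs (s ++ x :: t) =
  adjacent_pairs (rcons s x) + adjacent_pairs (x :: t).
Proof.
elim: s => [|a s IH]; first by rewrite /= pmax0.
by rewrite /= IH /= addnA; case: s {IH}.
Qed.

Lemma adjacent_pairs_rev s : adjacent_pairs (rev s) = adjacent_pairs s.
Proof.
elim: s => // a [|b s] IH //.
rewrite rev_cons rev_cons -cats1 cat_rcons adjacent_pairs_cat -rev_cons IH /=.
by rewrite !pmax0 (pmaxC a b); lia.
Qed.

Lemma not_both_sym v : symmetric (not_both v).
Proof. by move=> x y; rewrite /not_both andbC. Qed.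

Lemma sorted_not_both_split v s x t : sorted (not_both v) (s ++ x :: t) ->
  path (not_both v) x (rev s) /\ path (not_both v) x t.
Proof.
move=> H; split; last by have := cat_sorted2 H => -[].
move: H; rewrite -rev_sorted (eq_sorted (e' := not_both v)); last first.
  by move=> a b; rewrite not_both_sym.
by rewrite rev_cat rev_cons cat_rcons => /cat_sorted2[].
Qed.

Definition edge_bound (n E : nat) : Prop :=
  exists2 B, admissible n B & E + B <= 6 * n.

Lemma edge_bound_leq n E F : F <= E -> edge_bound n E -> edge_bound n F.
Proof. by move=> FE [B ? ?]; exists B => //; lia. Qed.

Lemma row_edges_sum s : all (leq 1) s ->
  row_edges s + size s = sumn s + adjacent_pairs s + skip_pairs s.
Proof.
rewrite /row_edges; elim: s => [|r s IH] /=; first by rewrite big_nil.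
by case/andP=> r0 /IH; rewrite big_cons; lia.
Qed.

Lemma row_edges_bound_balanced s (p := parity_maxima s) :
  s != [::] -> all (leq 1) s -> sorted (not_both 1) s ->
  p.1 <= p.2.+1 -> p.2 <= p.1.+1 -> edge_bound (sumn s) (row_edges s).
Proof.
move=> s0 pos s11 p12 p21.
have sp : skip_pairs s + p.1 + p.2 <= sumn s := skip_pairs_le s.
have posE := row_edges_sum pos.
pose M := maxn p.1 p.2; have Ms : M \in s := parity_maxima_mem s0.
pose b := p.1 != p.2.
have leM : all (geq M) s by apply/allP => x /parity_maxima_ge.
(* If the maxima of the two parities differ, [M] occurs at positions of one parity only, hence never
   in two adjacent rows. *)
have sM : b -> sorted (not_both M) s.
  rewrite /b => pneq; apply/(sortedP 0) => i si.
  have := parity_maxima_adjacent (take i s) (nth 0 s i) (nth 0 s i.+1) (drop i.+2 s).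
  rewrite -!drop_nth ?cat_take_drop -/p //; last exact: ltnW.
  by clear -pneq; rewrite /not_both /M; lia.
have M0 : 0 < M by have /allP/(_ _ Ms) := pos.
have split_s : exists s1 s2, s = s1 ++ M :: s2.
  by case/splitPr: Ms => s1 s2; exists s1, s2.
case: split_s => s1 [s2 sE].
have [p1L p1R] : path (not_both 1) M (rev s1) /\ path (not_both 1) M s2.
  by apply: sorted_not_both_split; rewrite -sE.
have pM : b -> path (not_both M) M (rev s1) /\ path (not_both M) M s2.
  by move=> hb; apply: sorted_not_both_split; rewrite -sE; apply: sM.
have [pL pR] : all (leq 1) (M :: rev s1) /\ all (leq 1) (M :: s2).
  by move: pos; rewrite sE all_cat /= all_rev => /and3P[-> -> ->].
have [mL mR] : all (geq M) (M :: rev s1) /\ all (geq M) (M :: s2).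
  by move: leM; rewrite sE all_cat /= all_rev => /and3P[-> -> ->].
have [|a0 [a1 [a2 [m [/= /andP[mM _] Mm /and3P[a0s a1s a2s] costL defL]]]]] :=
  outward_profile (b := b) pL mL p1L.
  by move=> /pM[].
have {mM Mm} mE : m = M by apply/eqP; rewrite eqn_leq Mm mM.
subst m.
have [|c0 [c1 [c2 [m [/= /andP[mM _] Mm /and3P[c0s c1s c2s] costR defR]]]]] :=
  outward_profile (b := b) pR mR p1R.
  by move=> /pM[].
have {mM Mm} mE : m = M by apply/eqP; rewrite eqn_leq Mm mM.
subst m.
have adjE : adjacent_pairs s = adjacent_pairs (M :: rev s1) + adjacent_pairs (M :: s2).
  by rewrite sE adjacent_pairs_cat -adjacent_pairs_rev rev_rcons.
have sumE : sumn s = sumn s1 + M + sumn s2 by rewrite sE sumn_cat /= addnA.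
have sizeE : size s = size s1 + (size s2).+1 by rewrite sE size_cat.
move: costL defL a0s a1s a2s; rewrite size_rev sumn_rev eqxx andbT addn0 => costL defL a0s a1s a2s.
move: defR; rewrite eqxx andbT addn0 => defR.
have pbM : p.1 + p.2 + b = 2 * M by clear -p12 p21; rewrite /M /b; case: eqP => /=; lia.
rewrite /= -/(adjacent_pairs _) in adjE costL costR defL defR.
(* With n points in h rows: n - h edges inside rows, at most 4 n - 4 M - 4 (h - 1) + 2 z0 + z1 + z2
   between adjacent rows (z_j summed over both sides) and n - 2 M + b between rows at distance
   two. *)
have BE : 5 * size s + 6 * M + row_edges s <= 6 * sumn s + b + 2 * (a0 + c0).+1 +
    (a1 + c1).+1 + (a2 + c2).+1.
  clear -sp posE costL costR sumE sizeE adjE pbM; lia.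
exists (6 * sumn s - row_edges s); last first.
  clear -BE a0s a1s a2s c0s c1s c2s sizeE M0; lia.
apply: (@profile_admissible b (size s) M (a0 + c0) (a1 + c1) (a2 + c2)).
- by clear -a0s c0s sizeE; lia.
- by clear -a1s c1s sizeE; lia.
- by clear -a2s c2s sizeE; lia.
- by [].
- have := sum_sq_bound a0 c0; have := sum_sq_bound a1 c1; have := sum_sq_bound a2 c2.
  move: defL defR.
  have -> : (if b then size s1 - a0 else 0) = b * (size s1 - a0) by case: (b); rewrite ?mul1n.
  have -> : (if b then size s2 - c0 else 0) = b * (size s2 - c0) by case: (b); rewrite ?mul1n.
  have bE : b * (size s1 - a0) + b * (size s2 - c0) = b * (size s - (a0 + c0).+1).
    by rewrite -mulnDr sizeE; congr (_ * _); clear -a0s c0s; lia.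
  have sME : size s * M = (size s1).+1 * M + (size s2).+1 * M - M.
    by rewrite sizeE; clear; nia.
  have M1 : M <= (size s1).+1 * M by rewrite leq_pmull.
  rewrite -[2 * b * _]mulnA -bE sME; clear -sumE M1.
  move: (_ * (_ - a0)) (_ * (_ - c0)) (odd _) (odd _) (odd _) => u v o0 o1 o2; lia.
- clear -BE a0s a1s a2s c0s c1s c2s sizeE M0; lia.
Qed.

(** * Remaining profiles, by removal of one point *)

Lemma admissible_step3 n B : 3 <= n -> admissible n B -> admissible n.+1 (B + 3).
Proof.
rewrite /admissible -!mulnn => n3 [le|[[k k1 nE] le]]; left.
  have : 15 <= B by nia.
  nia.
have : 24 <= B by nia.
nia.
Qed.

(** For the next n, B^2 has to grow by 96, or by 129 from an exceptional n: adding 3 to B is enough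
    from n = 3 on, adding 2 from n = 8 on. *)
Lemma admissible_step2 n B : 8 <= n -> admissible n B -> admissible n.+1 (B + 2).
Proof.
rewrite /admissible -!mulnn => n8 [le|[[k k1 nE] le]]; left.
  have : 27 <= B by nia.
  nia.
have k2 : k != 1 by apply/eqP => kE; move: nE n8; rewrite kE; lia.
have : 55 <= n by nia.
have : 72 <= B by nia.
nia.
Qed.

Lemma edge_bound_step3 n E F : 3 <= n -> F <= E + 3 ->
  edge_bound n E -> edge_bound n.+1 F.
Proof.
by move=> n3 FE [B aB le]; exists (B + 3); [exact: admissible_step3 | lia].
Qed.

Lemma edge_bound_step2 n E F : 8 <= n -> F <= E + 4 ->
  edge_bound n E -> edge_bound n.+1 F.
Proof.
by move=> n3 FE [B aB le]; exists (B + 2); [exact: admissible_step2 | lia].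
Qed.

Lemma split_last_occurrence (x : nat) s : x \in s ->
  exists s1 s2, s = s1 ++ x :: s2 /\ x \notin s2.
Proof.
elim: s => // a s IH; have [/IH [s1 [s2 [-> xs2]]] _|xs] := boolP (x \in s).
  by exists (a :: s1), s2.
by rewrite inE (negbTE xs) orbF => /eqP xa; exists [::], s; rewrite xa in xs *.
Qed.

Lemma row_edges_bound_peak s : all (leq 1) s -> 4 <= sumn s ->
    (forall s', all (leq 1) s' -> (sumn s').+1 = sumn s ->
      edge_bound (sumn s') (row_edges s')) ->
    ~~ ((parity_maxima s).1 <= (parity_maxima s).2.+1) ||
    ~~ ((parity_maxima s).2 <= (parity_maxima s).1.+1) ->
  edge_bound (sumn s) (row_edges s).
Proof.
move=> pos n4 IH; set p := parity_maxima s => gap.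
have s0 : s != [::] by apply: contraTneq n4 => ->.
have [M ME] : exists M, M = maxn p.1 p.2 by eexists.
have Ms : M \in s by rewrite ME; apply: parity_maxima_mem.
(* Choosing the last largest row makes the row two places after it strictly shorter. *)
have [s1 [s2 [sE Ms2]]] := split_last_occurrence Ms.
have M2 : 2 <= M by clear -gap ME; lia.
have leM x : x \in s -> x <= M by move=> /parity_maxima_ge; rewrite ME.
have near u x y v : s = u ++ x :: y :: v -> maxn x y = M -> minn x y + 2 <= M.
  move=> sE2; have := parity_maxima_adjacent u x y v; rewrite -sE2 -/p ME.
  by clear -gap; lia.
have headM : head 0 s2 + 2 <= M.
  case: s2 Ms2 sE => [//|y s2] Ms2 sE.
  have := near _ _ _ _ sE.
  have := leM y; rewrite sE mem_cat !inE eqxx !orbT => /(_ isT); clear.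
  by rewrite /=; lia.
have nthM : nth 0 s2 1 < M.
  case: s2 Ms2 sE {headM} => [|y [|z s2]] Ms2 sE; try by apply: leq_trans M2.
  have := leM z; rewrite sE mem_cat !inE eqxx !orbT => /(_ isT).
  by move: Ms2; rewrite !inE !negb_or; clear; rewrite /=; lia.
have step E : edge_bound (sumn s).-1 E -> row_edges s <= E + 3 -> edge_bound (sumn s) (row_edges s).
  move=> bE le; have -> : sumn s = (sumn s).-1.+1 by clear -n4; lia.
  by apply: edge_bound_step3 le bE; clear -n4; lia.
have IHs : edge_bound (sumn s).-1 (row_edges (s1 ++ M.-1 :: s2)).
  have sumE : (sumn (s1 ++ M.-1 :: s2)).+1 = sumn s.
    by rewrite sE !sumn_cat /=; clear -M2; lia.
  rewrite -sumE; apply: IH => //.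
  move: pos; rewrite sE !all_cat /= => /and3P[-> _ ->].
  by rewrite andbT /=; clear -M2; lia.
case: (lastP s1) sE IHs => [|s1' c] sE IHs.
  apply: step IHs _; rewrite sE /=.
  by apply: leq_trans (row_edges_decr0 headM nthM) _; clear; lia.
have cM : c + 2 <= M.
  have cs : c <= M by apply: leM; rewrite sE mem_cat mem_rcons mem_head.
  have := near s1' c M s2; rewrite sE cat_rcons => /(_ erefl).
  by clear -cs; lia.
case: (lastP s1') sE IHs => [|s1'' b] sE IHs.
  apply: step IHs _; rewrite sE /=.
  by apply: leq_trans (row_edges_decr1 cM headM nthM) _; clear; lia.
rewrite !cat_rcons in sE IHs.
have decr := row_edges_decr2 s1'' b cM headM nthM; rewrite -sE in decr.
have [small|big] := leqP (2 + (0 < head 0 s2) + (M <= b)) 3.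
  by apply: step IHs _; clear -decr small; lia.
have c0 : 0 < c by move: pos; rewrite sE all_cat /= => /and4P[].
have bM : M <= b by clear -big; lia.
case: s2 big sE {headM nthM Ms2 near} IHs decr => [|d s2] /= big sE IHs decr.
  by clear -big; lia.
have d0 : 0 < d by clear -big; lia.
have nE : sumn s = sumn s1'' + (b + (c + (M + (d + sumn s2)))).
  by rewrite sE sumn_cat.
(* A loss of four edges is affordable only when at least 8 points remain; with fewer, the profile
   can only be 3, 1, 3, 1. *)
have [n9|n8] := leqP 9 (sumn s).
  have -> : sumn s = (sumn s).-1.+1 by clear -n4; lia.
  by apply: edge_bound_step2 IHs; [clear -n9; lia|clear -decr; lia].
have zero (t : seq nat) : all (leq 1) t -> sumn t = 0 -> t = [::].
  by case: t => [//|[] ? ?].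
have sE2 : s = [:: 3; 1; 3; 1].
  rewrite sE [s1'']zero; last by clear -nE n8 bM cM c0 d0; lia.
    rewrite [s2]zero; last by clear -nE n8 bM cM c0 d0; lia.
      by congr [:: _; _; _; _]; clear -nE n8 bM cM c0 d0; lia.
    by move: pos; rewrite sE all_cat /= => /and5P[_ _ _ _ /andP[]].
  by move: pos; rewrite sE all_cat /= => /andP[].
by rewrite sE2 /row_edges unlock /=; exists 27; [left|].
Qed.

Lemma not_sorted_not_both v s : ~~ sorted (not_both v) s ->
  exists s1 s2, s = s1 ++ v :: v :: s2.
Proof.
elim: s => // a [|b s] //= IH; rewrite negb_and negbK => /orP[/andP[/eqP-> /eqP->]|].
  by exists [::], s.
by case/IH => s1 [s2 ->]; exists (a :: s1), s2.
Qed.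

Theorem row_edges_bound s : all (leq 1) s -> 3 <= sumn s ->
  edge_bound (sumn s) (row_edges s).
Proof.
have [n] := ubnP (sumn s); elim: n s => // n IH s sn pos n3.
have [n4|n4] := leqP (sumn s) 3.
  have -> : sumn s = 3 by lia.
  apply: (@edge_bound_leq 3 3); last by exists 15; [left|].
  have [s0|[s0 s3]] : s = [::] \/ s != [::] /\ sumn s = 3 by case: (s) n4 n3 => //=; right; split=> //; lia.
    by rewrite s0 in n3.
  rewrite /row_edges; case: s {sn IH n4 n3 s0} pos s3 => [|a [|b [|c [|d s]]]] //=.
  - by rewrite unlock /=; case: a => [|[|[|[|a]]]].
  - by rewrite unlock /=; case: a => [|[|[|[|a]]]] //; case: b => [|[|[|[|b]]]].
  - by rewrite unlock /=; case: a => [|[|[|[|a]]]] //; case: b => [|[|[|[|b]]]] //; case: c => [|[|[|[|c]]]].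
  - by move=> /and5P[a0 b0 c0 d0 _]; lia.
have [s11|] := boolP (sorted (not_both 1) s); last first.
  case/not_sorted_not_both => s1 [s2 sE].
  have sumE : sumn s = (sumn (s1 ++ 1 :: s2)).+1.
    by rewrite sE !sumn_cat /=; lia.
  have pos1 : all (leq 1) s1 by move: pos; rewrite sE all_cat => /andP[].
  rewrite sumE; apply: edge_bound_step3 (IH _ _ _ _); try lia.
    by rewrite sE; apply: leq_trans (row_edges_dup1 _ pos1) _; lia.
  by move: pos; rewrite sE !all_cat /= => /andP[->].
have s0 : s != [::] by apply: contraTneq n4 => ->.
have [/andP[p1 p2]|gap] := boolP (((parity_maxima s).1 <= (parity_maxima s).2.+1) &&
     ((parity_maxima s).2 <= (parity_maxima s).1.+1)).
  exact: row_edges_bound_balanced.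
apply: row_edges_bound_peak => //; last by rewrite -negb_and.
move=> s' pos' sE; apply: IH => //; lia.
Qed.

(** * From point sets to row profiles *)

Local Open Scope classical_set_scope.
Local Open Scope ring_scope.

Lemma count_window (s : seq int) (l : int) (k : nat) : uniq s ->
  (count (fun b => l <= b < l + k%:Z)%R s <= k)%N.
Proof.
move=> us; elim: k => [|k IH].
  by rewrite (eq_count (a2 := pred0)) ?count_pred0 // => b /=; lia.
rewrite (eq_count (a2 := predU (fun b => l <= b < l + k%:Z) (pred1 (l + k%:Z)))); last first.
  by move=> b /=; lia.
apply: leq_trans (leq_addr (count (predI (fun b => l <= b < l + k%:Z) (pred1 (l + k%:Z))) s) _) _.
by rewrite count_predUI -addn1 leq_add // count_uniq_mem // leq_b1.
Qed.

Lemma count_in_window (P : pred int) (s : seq int) (l : int) (k : nat) :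
  uniq s -> {in s, forall x, P x -> l <= x < l + k%:Z} -> (count P s <= k)%N.
Proof.
move=> us H; apply: leq_trans (count_window l k us).
rewrite (eq_in_count (a2 := predI P (fun x => l <= x < l + k%:Z))).
  by apply: sub_count => x /andP[].
by move=> x xs /=; case Px: (P x) => //=; rewrite H.
Qed.

Definition close (a b : int) : bool := -2 <= b - a <= 1.

Definition close_pairs (A B : seq int) : nat :=
  \sum_(a <- A) count (close a) B.

Lemma close_pairs_le_mul A B : (close_pairs A B <= size A * size B)%N.
Proof.
rewrite /close_pairs; elim: A => [|a A IH]; first by rewrite big_nil.
by rewrite big_cons mulSn leq_add // count_size.
Qed.

Lemma close_pairs_cons a A b B : close_pairs (a :: A) (b :: B) =
  (close a b + count (close a) B + count (close ^~ b) A + close_pairs A B)%N.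
Proof.
rewrite /close_pairs big_cons /= -!addnA; congr (_ + (_ + _))%N.
elim: A => [|c A IH]; first by rewrite !big_nil.
by rewrite !big_cons IH /=; lia.
Qed.

(* The minima [a] of [A] and [b] of [B] lie in at most four close pairs: if
   [b - a = j] with [-2 <= j <= 1], then [a] is close to at most [1 - j]
   elements of [B] above [b], and [b] to at most [j + 2] of [A] above [a]. *)
Lemma close_pairs_min a A b B : uniq A -> uniq B ->
  all (> a) A -> all (> b) B ->
  (close_pairs (a :: A) (b :: B) <= close_pairs A B + 4)%N.
Proof.
move=> uA uB /allP Aa /allP Bb; rewrite close_pairs_cons.
suff : (close a b + count (close a) B + count (close ^~ b) A <= 4)%N by lia.
have cA l (k : nat) : (forall x : int, a < x -> close x b -> l <= x < l + k%:Z) ->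
    (count (close ^~ b) A <= k)%N.
  by move=> H; apply: (count_in_window (l := l)) => // x /Aa; exact: H.
have cB l (k : nat) : (forall x : int, b < x -> close a x -> l <= x < l + k%:Z) ->
    (count (close a) B <= k)%N.
  by move=> H; apply: (count_in_window (l := l)) => // x /Bb; exact: H.
have [j0|j0] := ltP (b - a) (-2).
  have := cA a 0%N; have := cB (a - 2) 4%N; rewrite /close.
  move=> /(_ ltac:(by lia)) H1 /(_ ltac:(by lia)) H2; lia.
have [j1|j1] := ltP 1 (b - a).
  have := cB b 0%N; have := cA (b - 1) 4%N; rewrite /close.
  move=> /(_ ltac:(by lia)) H1 /(_ ltac:(by lia)) H2; lia.
have := cB (b + 1) `|(1 - (b - a))%R|%N; have := cA (a + 1) `|(b - a + 2)%R|%N.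
rewrite /close => /(_ ltac:(by lia)) H1 /(_ ltac:(by lia)) H2; lia.
Qed.

Lemma close_pairs_bound A B : uniq A -> uniq B ->
  (close_pairs A B <= pmax (size A) (size B))%N.
Proof.
have sorted_case : forall A B : seq int, sorted <%R A -> sorted <%R B ->
    (close_pairs A B <= pmax (size A) (size B))%N.
  elim=> [|a {}A IH] [|b {}B] sA sB.
  - by rewrite /close_pairs big_nil.
  - by rewrite /close_pairs big_nil.
  - by have := close_pairs_le_mul (a :: A) [::]; rewrite muln0 leqn0 => /eqP ->.
  rewrite /= leq_min (close_pairs_le_mul (a :: A) (b :: B)) /=.
  have [/= /andP[aA uA] /andP[bB uB]] := (lt_sorted_uniq sA, lt_sorted_uniq sB).
  apply: leq_trans (close_pairs_min uA uB (order_path_min lt_trans sA)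
    (order_path_min lt_trans sB)) _.
  by rewrite leq_add2r IH // (path_sorted sA, path_sorted sB).
move=> uA uB; have := sorted_case (sort <=%R A) (sort <=%R B).
rewrite !sort_lt_sorted !size_sort => /(_ uA uB); congr (_ <= _)%N.
rewrite /close_pairs (perm_big A) /=; last by rewrite perm_sort.
by apply: eq_bigr => a _; apply/permP; rewrite perm_sort.
Qed.

(* The point [(m, n)] stands for [m g_1 + n g_2]; [Up] is one half of [U]. *)
Notation point := (int * int)%type.

Definition Up : seq point :=
  [:: (1, 0); (1, 1); (0, 1); (-1, 2); (-1, 1); (-2, 1)].

Definition edges (s : seq point) : nat :=
  \sum_(u <- Up) count (fun x => (x + u)%R \in s) s.

Definition row (s : seq point) (y : int) : seq int :=
  [seq x.1 | x <- s & x.2 == y].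

Lemma mem_row s x y : (x \in row s y) = ((x, y) \in s).
Proof.
apply/mapP/idP => [[[a b]]|xs].
  by rewrite mem_filter /= => /andP[/eqP <- abs] ->.
by exists (x, y) => //; rewrite mem_filter eqxx.
Qed.

Lemma row_uniq s y : uniq s -> uniq (row s y).
Proof.
move=> us; rewrite map_inj_in_uniq ?filter_uniq // => -[a b] [c d].
by rewrite !mem_filter /= => /andP[/eqP -> _] /andP[/eqP -> _] ->.
Qed.

Lemma row_support (s : seq point) : exists (y0 : int) (h : nat),
  forall x, x \in s -> y0 <= x.2 < y0 + h%:Z.
Proof.
suff [h H] : exists h : nat, forall x, x \in s -> (`|x.2| < h)%N.
  by exists (- h%:Z), (2 * h)%N => x /H; lia.
elim: s => [|a s [h H]]; first by exists 0%N.
exists (maxn h `|a.2|%N.+1) => x; rewrite inE => /orP[/eqP -> | /H xh].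
  by rewrite leq_max leqnn orbT.
by rewrite leq_max xh.
Qed.

Lemma count_rows (P : int -> int -> bool) (s : seq point) (y0 : int) (h : nat) :
  (forall x, x \in s -> y0 <= x.2 < y0 + h%:Z) ->
  count (fun x => P x.1 x.2) s =
  \sum_(i < h) count (P^~ (y0 + i%:Z)%R) (row s (y0 + i%:Z)%R).
Proof.
elim: s => [|[x y] s IH] H; first by rewrite /= big1.
rewrite /= IH => [|z zs]; last by apply: H; rewrite inE zs orbT.
have /= xb := H _ (mem_head _ _).
have [k kh kE] : exists2 k : nat, (k < h)%N & y0 + k%:Z = y.
  by exists (absz (y - y0)); lia.
rewrite (bigD1 (Ordinal kh)) //= [RHS](bigD1 (Ordinal kh)) //= addnA; congr (_ + _)%N.
  by rewrite kE /row /= eqxx.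
apply: eq_bigr => i ne; rewrite /row /=.
suff /negbTE -> : y != y0 + i%:Z by [].
by apply: contra ne => /eqP xE; apply/eqP/val_inj => /=; lia.
Qed.

Lemma row_edges_mkseq (f : nat -> nat) (h : nat) :
  (forall m, (h <= m)%N -> f m = 0%N) ->
  row_edges (mkseq f h) =
  \sum_(i < h) ((f i).-1 + pmax (f i) (f i.+1) + minn (f i) (f i.+2))%N.
Proof.
elim: h f => [|h IH] f f0; first by rewrite big_ord0 row_edges_nil.
have mkS : mkseq f h.+1 = f 0%N :: mkseq (f \o S) h.
  by rewrite /mkseq /= -[1%N]addn0 iotaDl -map_comp.
rewrite mkS row_edges_cons IH => [|m hm]; last by rewrite /= f0.
rewrite big_ord_recl addnC; congr (_ + _)%N.
have hd (k : nat) (g : nat -> nat) : (forall m, (k <= m)%N -> g m = 0%N) ->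
    forall j, nth 0%N (mkseq g k) j = g j.
  move=> g0 j; have [jk|kj] := ltnP j k; first by rewrite nth_mkseq.
  by rewrite nth_default ?size_mkseq // g0.
by rewrite -nth0 !hd // => m hm; rewrite /= f0.
Qed.

(** The four shifts are the elements of [Up] that lead to the next row. *)
Lemma count_shift_close (A B : seq int) : uniq B ->
  (count (fun a => (a + 1)%R \in B) A + (count (fun a => a \in B) A +
   (count (fun a => (a - 1)%R \in B) A + count (fun a => (a - 2)%R \in B) A)))%N =
  close_pairs A B.
Proof.
have AC (p q r t c d e f : nat) : (p + c + (q + d + (r + e + (t + f))) =
  p + q + r + t + (c + (d + (e + f))))%N by lia.
move=> uB; rewrite /close_pairs; elim: A => [|a A IH]; first by rewrite big_nil.
rewrite big_cons /= -IH.
suff -> : count (close a) B = (((a + 1)%R \in B) + (a \in B) + ((a - 1)%R \in B) + ((a - 2)%R \in B))%N.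
  exact: AC.
rewrite -!(count_uniq_mem _ uB).
elim: B {uB IH} => //= b B ->.
suff -> : close a b = ((b == a + 1)%R + (b == a) + (b == a - 1)%R + (b == a - 2)%R)%N :> nat by lia.
by rewrite /close; lia.
Qed.

Lemma count_pred_row (B : seq int) : uniq B ->
  (count (fun a => (a + 1)%R \in B) B <= (size B).-1)%N.
Proof.
move=> uB; have [->//|B0] := eqVneq B [::].
have [m mB mmax] : exists2 m, m \in B & {in B, forall x, x <= m}.
  elim: B B0 {uB} => // b B IH _; have [->|/IH [m mB mM]] := eqVneq B [::].
    by exists b; rewrite ?mem_head // => x; rewrite inE => /eqP ->.
  have [bm|mb] := leP b m.
    by exists m; rewrite ?inE ?mB ?orbT // => x; rewrite inE => /orP[/eqP -> //|/mM].
  exists b; rewrite ?mem_head // => x; rewrite inE => /orP[/eqP -> //|/mM].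
  by move/le_trans => -> //; exact: ltW.
rewrite -(size_rem mB) -size_filter; apply: uniq_leq_size; first exact: filter_uniq.
move=> x; rewrite mem_filter mem_rem_uniq // inE => /andP[x1 ->]; rewrite andbT.
by apply: contraTneq x1 => ->; apply/negP => /mmax; lia.
Qed.

Theorem edges_bound (s : seq point) : uniq s -> (3 <= size s)%N ->
  edge_bound (size s) (edges s).
Proof.
move=> us s3; have [y0 [h H]] := row_support s.
pose f (i : nat) := size (row s (y0 + i%:Z)).
have f0 m : (h <= m)%N -> f m = 0%N.
  rewrite /f => hm; case rE: (row s _) => [//|a r].
  have : a \in row s (y0 + m%:Z) by rewrite rE mem_head.
  by rewrite mem_row => /H /=; lia.
pose t := [seq r <- mkseq f h | (0 < r)%N].
have sumf : sumn (mkseq f h) = size s.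
  rewrite sumnE big_map -{1}(subn0 h) -/(index_iota 0 h) big_mkord.
  have := count_rows (fun _ _ => true) H.
  by rewrite count_predT => ->; apply: eq_bigr => i _; rewrite count_predT.
have sumt : sumn t = size s.
  rewrite -sumf /t; elim: (mkseq f h) => //= x l IH.
  by case: (posnP x) => [->|x0] //=; rewrite IH.
have post : all (leq 1) t by apply: filter_all.
have := row_edges_bound post; rewrite sumt => /(_ s3).
apply: edge_bound_leq.
apply: leq_trans (row_edges_filter _).
rewrite row_edges_mkseq //.
have cu (u v : int) : count (fun x => x + (u, v) \in s) s =
    \sum_(i < h) count (fun a => (a + u)%R \in row s (y0 + i%:Z + v)%R) (row s (y0 + i%:Z)%R).
  rewrite -(count_rows (fun a b => a + u \in row s (b + v)) H).
  by apply: eq_count => -[a b] /=; rewrite mem_row.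
rewrite /edges /Up !big_cons big_nil addn0 !cu -!big_split /=.
apply: leq_sum => i _; rewrite addr0.
have r1 : y0 + i%:Z + 1 = y0 + i.+1%:Z by lia.
have r2 : y0 + i%:Z + 2 = y0 + i.+2%:Z by lia.
rewrite r1 r2; set A := row s (y0 + i%:Z); set B := row s _; set C := row s _.
have [uA uB uC] : [/\ uniq A, uniq B & uniq C] by split; apply: row_uniq.
have H1 := count_pred_row uA.
have H2 := close_pairs_bound uA uB; rewrite -(count_shift_close _ uB) in H2.
have H3 : (count (fun a => (a - 1)%R \in C) A <= minn (size A) (size C))%N.
  rewrite leq_min count_size -size_filter -(size_map (fun a => a - 1)).
  apply: uniq_leq_size => [|x /mapP[a]]; last by rewrite mem_filter => /andP[aC _] ->.
  by rewrite map_inj_uniq ?filter_uniq // => x y /addIr.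
rewrite (eq_count (a1 := fun a => a + 0 \in B) (a2 := mem B)) => [|a]; last by rewrite /= addr0.
have sum_le (a p q c r v x y z : nat) : (a <= x)%N ->
    (p + (q + (r + v)) <= y)%N -> (c <= z)%N ->
    (a + (p + (q + (c + (r + v)))) <= x + y + z)%N by lia.
by rewrite /f -/A -/B -/C; apply: sum_le H1 H2 H3.
Qed.

(** * A nested family of twelve-gons *)

(* [normals] lists the outer normals of the twelve sides, as linear forms; the
   side with normal [nth 0 normals m] has direction [nth 0 side_dirs m]. *)
Definition side_dirs : seq point :=
  [:: (1, 0); (0, 1); (-1, 1); (1, 1); (-1, 2); (-2, 1);
      (1, 0); (0, 1); (-1, 1); (1, 1); (-1, 2); (-2, 1)].

Definition normals : seq point :=
  [:: (0, -1); (1, 0); (1, 1); (1, -1); (2, 1); (1, 2);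
      (0, 1); (-1, 0); (-1, -1); (-1, 1); (-2, -1); (-1, -2)].

Definition form (m : nat) (p : point) : int :=
  (nth 0 normals m).1 * p.1 + (nth 0 normals m).2 * p.2.

Definition entry (m : nat) (p q : point) (e : nat) := (m, p, q, e).

(* The entry [entry m p q e] of index [j] describes the layer added at step [j]
   of round [k]: on side [m], it consists of the [k + e - 1] points
   [p + q *~ k + u *+ i], where [u] is the direction of side [m].
   Each round adds three layers to each short side and five to each long one;
   the order of the sides was found by computer search. *)
Definition layer_table : seq (nat * point * point * nat) :=
  [:: entry 3 (0, 2) (2, -3) 0; entry 0 (1, 1) (1, -3) 0; entry 11 (0, 1) (1, -3) 1;
      entry 1 (-1, 1) (3, -2) 0; entry 3 (0, 1) (2, -3) 1; entry 4 (-1, 0) (3, -1) 1;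
      entry 2 (-1, 0) (2, 1) 0; entry 4 (-1, 1) (3, -1) 1; entry 5 (0, -1) (1, 2) 1;
      entry 1 (0, 1) (3, -2) 0; entry 3 (1, 1) (2, -3) 1; entry 4 (0, 0) (3, -1) 1;
      entry 0 (2, 0) (1, -3) 0; entry 3 (1, 0) (2, -3) 1; entry 11 (1, 0) (1, -3) 1;
      entry 8 (1, 0) (-1, -2) 1; entry 10 (1, 0) (-2, -1) 1; entry 11 (0, 0) (1, -3) 1;
      entry 0 (2, -1) (1, -3) 0; entry 3 (1, -1) (2, -3) 1; entry 1 (1, -1) (3, -2) 1;
      entry 4 (1, -1) (3, -1) 1; entry 2 (1, -1) (2, 1) 1; entry 5 (1, -1) (1, 2) 1;
      entry 6 (2, -1) (-2, 3) 1; entry 9 (2, 0) (-3, 2) 1; entry 7 (1, 0) (-3, 1) 1;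
      entry 10 (0, 1) (-2, -1) 1; entry 8 (0, 0) (-1, -2) 1; entry 11 (1, -1) (1, -3) 2;
      entry 4 (1, 0) (3, -1) 1; entry 5 (0, 0) (1, 2) 1; entry 2 (1, 0) (2, 1) 1;
      entry 5 (1, 0) (1, 2) 1; entry 6 (2, 0) (-2, 3) 1; entry 9 (1, 0) (-3, 2) 2;
      entry 9 (1, 1) (-3, 2) 1; entry 7 (0, 1) (-3, 1) 1; entry 10 (0, 0) (-2, -1) 2;
      entry 5 (0, 1) (1, 2) 1; entry 6 (1, 1) (-2, 3) 1; entry 9 (0, 1) (-3, 2) 2;
      entry 9 (0, 2) (-3, 2) 1; entry 7 (-1, 2) (-3, 1) 1; entry 10 (-1, 1) (-2, -1) 2;
      entry 8 (-1, 0) (-1, -2) 1; entry 10 (-1, 0) (-2, -1) 2; entry 11 (0, -1) (1, -3) 2].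

Definition layer_entry (j : nat) : nat * point * point * nat :=
  nth (0%N, 0, 0, 0%N) layer_table j.
Definition side j : nat := (layer_entry j).1.1.1.
Definition start0 j : point := (layer_entry j).1.1.2.
Definition start1 j : point := (layer_entry j).1.2.
Definition extra j : nat := (layer_entry j).2.
Definition dir j : point := nth 0 side_dirs (side j).
Definition sides : seq nat := [seq e.1.1.1 | e <- layer_table].

(** Each layer moves its side out by one. The constants make the shape with k = 1 and j = 0 the
    seven-point [hexagon]. *)
Definition bound0 (j m : nat) : int :=
  (if (m %% 6 < 3)%N then -2 else -3) + (count_mem m (take j sides))%:Z.
Definition bound1 (m : nat) : int := if (m %% 6 < 3)%N then 3 else 5.

Definition in_shape (k j : nat) (p : point) : bool :=
  all (fun m => form m p <= bound0 j m + bound1 m * k%:Z) (iota 0 12).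

Definition layer_point (k j : nat) (i : int) : point :=
  ((start0 j).1 + (start1 j).1 * k%:Z + (dir j).1 * i,
   (start0 j).2 + (start1 j).2 * k%:Z + (dir j).2 * i).

Definition layer_size (k j : nat) : nat := (k + extra j).-1.

Definition layer (k j : nat) : seq point :=
  [seq layer_point k j i%:Z | i <- iota 0 (layer_size k j)].

(* On the line of layer [(k, j)], the slack of [p + v] with respect to side
   [m] of shape [(k, j')] is affine in [k] and [i], with these coefficients. *)
Definition slack0 (j j' m : nat) (v : point) : int :=
  bound0 j' m - form m (start0 j) - form m v.
Definition slack1 (j m : nat) : int := bound1 m - form m (start1 j).
Definition slack2 (j m : nat) : int := - form m (dir j).

Lemma formD m p q : form m (p + q) = form m p + form m q.
Proof. by rewrite /form /=; ring. Qed.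

Lemma slackE k j j' m v i :
  bound0 j' m + bound1 m * k%:Z - form m (layer_point k j i + v) =
  slack0 j j' m v + slack1 j m * k%:Z + slack2 j m * i.
Proof.
by rewrite formD /slack0 /slack1 /slack2 {1}/form /layer_point /= /form; ring.
Qed.

(** Nonnegativity of a + b k + c i for k >= K and 0 <= i <= k + e - 2: an affine function is tested
    at the two corners k = K and along the two unbounded edges, so one computation settles all k. *)
Definition nonneg_on_layer (a b c : int) (e K : nat) : bool :=
  [&& 0 <= b, 0 <= a + b * K%:Z, 0 <= b + c &
      0 <= a + c * (e%:Z - 2) + (b + c) * K%:Z].

Lemma nonneg_on_layerP a b c e K k i : nonneg_on_layer a b c e K ->
  (K <= k)%N -> (i < (k + e).-1)%N -> 0 <= a + b * k%:Z + c * i%:Z.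
Proof.
case/and4P=> b0 a0 bc0 ac0 Kk ik.
have bk : b * K%:Z <= b * k%:Z by apply: ler_wpM2l => //; lia.
have bck : (b + c) * K%:Z <= (b + c) * k%:Z by apply: ler_wpM2l => //; lia.
have [c0|c0] := leP 0 c.
  have : 0 <= c * i%:Z by apply: mulr_ge0.
  lia.
have : c * (k%:Z + e%:Z - 2) <= c * i%:Z.
  by apply: ler_wnM2l; [exact: ltW | lia].
lia.
Qed.

Lemma layer_in_shape_check :
  all (fun j => all (fun m => nonneg_on_layer (slack0 j j.+1 m 0) (slack1 j m)
    (slack2 j m) (extra j) 2) (iota 0 12)) (iota 0 48).
Proof. by vm_compute. Qed.

(** For k = 1 a layer with [extra] 0 is empty, and the criterion would test the point i = -1, which
    lies outside the shape. *)
Lemma layer_in_shape_check1 :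
  all (fun j => all (in_shape 1 j.+1) (layer 1 j)) (iota 0 48).
Proof. by vm_compute. Qed.

Lemma in_shapeP k j p : reflect
  (forall m, (m < 12)%N -> form m p <= bound0 j m + bound1 m * k%:Z)
  (in_shape k j p).
Proof.
apply: (iffP allP) => H m; first by move=> m12; apply: H; rewrite mem_iota.
by rewrite mem_iota => /andP[_ ?]; apply: H.
Qed.

Lemma layer_in_shape k j p : (0 < k)%N -> (j < 48)%N ->
  p \in layer k j -> in_shape k j.+1 p.
Proof.
move=> k0 j48; have [k2|k2] := leqP 2 k; last first.
  have -> : k = 1%N by lia.
  by have /allP/(_ j) := layer_in_shape_check1; rewrite mem_iota j48 => /(_ isT)/allP/(_ p).
case/mapP=> i; rewrite mem_iota => /andP[_ ik] ->; apply/in_shapeP => m m12.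
have /allP/(_ j) := layer_in_shape_check; rewrite mem_iota j48 => /(_ isT).
move/allP/(_ m); rewrite mem_iota m12 => /(_ isT) /nonneg_on_layerP.
move=> /(_ k i k2 ik); rewrite -slackE addr0; lia.
Qed.

Lemma layer_line_check : all (fun j =>
  [&& slack0 j j (side j) 0 == -1, slack1 j (side j) == 0, slack2 j (side j) == 0 &
      (side j < 12)%N]) (iota 0 48).
Proof. by vm_compute. Qed.

Lemma side_lt j : (j < 48)%N -> (side j < 12)%N.
Proof.
by move=> j48; have /allP/(_ j) := layer_line_check;
  rewrite mem_iota j48 => /(_ isT)/and4P[].
Qed.

Lemma form_layer_point k j i : (j < 48)%N ->
  form (side j) (layer_point k j i) =
  bound0 j (side j) + bound1 (side j) * k%:Z + 1.
Proof.
move=> j48; have /allP/(_ j) := layer_line_check; rewrite mem_iota j48.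
case/(_ isT)/and4P=> /eqP s0 /eqP s1 /eqP s2 _.
have := slackE k j j (side j) 0 i; rewrite s0 s1 s2 addr0; lia.
Qed.

Lemma bound0S j m : (j < 48)%N -> bound0 j.+1 m = bound0 j m + (side j == m)%:Z.
Proof.
move=> j48; rewrite /bound0 (take_nth 0%N) ?size_map // -cats1 count_cat /= addn0.
have -> : nth 0%N sides j = side j by rewrite (nth_map (0%N, 0, 0, 0%N)).
by rewrite PoszD addrA.
Qed.

Lemma form0_dir m q : (m < 12)%N -> form m q = 0 ->
  exists t, q = ((nth 0 side_dirs m).1 * t, (nth 0 side_dirs m).2 * t).
Proof.
case: q => x y m12.
by do 12 (case: m m12 => [|m] m12; [rewrite /form /= => E;
  (exists x + exists y + exists (- x)); congr (_, _); lia|]).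
Qed.

(** Each of the points i = -1 and i = k + e - 1 violates some side. The slack there does not
    increase with k, so k = 1 decides, and the sign of [slack2] excludes all points beyond. *)
Lemma layer_ends_check : all (fun j =>
  has (fun m => [&& 0 <= slack2 j m, slack1 j m <= 0 &
     slack0 j j.+1 m 0 + slack1 j m - slack2 j m < 0]) (iota 0 12) &&
  has (fun m => [&& slack2 j m <= 0, slack1 j m + slack2 j m <= 0 &
     slack0 j j.+1 m 0 + slack2 j m * ((extra j)%:Z - 1) +
     (slack1 j m + slack2 j m) < 0]) (iota 0 12)) (iota 0 48).
Proof. by vm_compute. Qed.

Lemma line_in_shape_layer k j p : (0 < k)%N -> (j < 48)%N ->
  form (side j) p = bound0 j (side j) + bound1 (side j) * k%:Z + 1 ->
  in_shape k j.+1 p -> p \in layer k j.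
Proof.
move=> k0 j48 pl /in_shapeP ps.
have [t tE] : exists t, p - layer_point k j 0 = ((dir j).1 * t, (dir j).2 * t).
  apply: form0_dir (side_lt j48) _.
  have := form_layer_point k 0 j48; rewrite -pl => E.
  by have := formD (side j) (p - layer_point k j 0) (layer_point k j 0); rewrite subrK E; lia.
have {tE} pE : p = layer_point k j t.
  rewrite -[p](subrK (layer_point k j 0)) tE /layer_point.
  by congr (_, _) => /=; rewrite mulr0; ring.
have {}ps m : (m < 12)%N ->
    0 <= slack0 j j.+1 m 0 + slack1 j m * k%:Z + slack2 j m * t.
  by move/ps; rewrite -slackE addr0 -pE; lia.
have /allP/(_ j) := layer_ends_check; rewrite mem_iota j48 => /(_ isT) /andP[].
case/hasP=> m; rewrite mem_iota => /ps {}m1 /and3P[a1 b1 c1].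
case/hasP=> n; rewrite mem_iota => /ps {}n1 /and3P[a2 b2 c2].
have t0 : 0 <= t.
  rewrite leNgt; apply/negP => t0.
  have : slack2 j m * t <= slack2 j m * (-1) by apply: ler_wpM2l => //; lia.
  have : slack1 j m * k%:Z <= slack1 j m * 1 by apply: ler_wnM2l => //; lia.
  by move: m1 c1; clear; lia.
have tk : t < (layer_size k j)%:Z.
  rewrite ltNge; apply/negP => kt.
  have : slack2 j n * t <= slack2 j n * (k%:Z + (extra j)%:Z - 1).
    by apply: ler_wnM2l => //; rewrite /layer_size in kt; lia.
  have : (slack1 j n + slack2 j n) * k%:Z <= (slack1 j n + slack2 j n) * 1.
    by apply: ler_wnM2l => //; lia.
  by move: n1 c2; clear; lia.
apply/mapP; exists `|t|%N; first by rewrite mem_iota; lia.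
by rewrite pE gez0_abs.
Qed.

(** Only the bound of [side j] changes, and by one, so all new points lie on a single line. *)
Lemma in_shapeS k j p : (0 < k)%N -> (j < 48)%N ->
  in_shape k j.+1 p = in_shape k j p || (p \in layer k j).
Proof.
move=> k0 j48; apply/idP/orP => [ps|[/in_shapeP ps|]]; last exact: layer_in_shape.
  have [|notin] := boolP (in_shape k j p); first by left.
  right; apply: line_in_shape_layer => //.
  case/allPn: notin => m; rewrite mem_iota => /= m12; rewrite -ltNge.
  have := in_shapeP _ _ _ ps m m12; rewrite bound0S //.
  case: eqP => [->|_]; lia.
by apply/in_shapeP => m /ps; rewrite bound0S //; case: eqP; lia.
Qed.

Lemma layer_not_in_shape k j p : (j < 48)%N -> p \in layer k j -> ~~ in_shape k j p.
Proof.
move=> j48 /mapP[i _ ->]; apply/negP => /in_shapeP/(_ _ (side_lt j48)).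
by rewrite form_layer_point //; lia.
Qed.

Lemma dir_neq0_check : all (fun j => dir j != 0) (iota 0 48).
Proof. by vm_compute. Qed.

Lemma layer_uniq k j : (j < 48)%N -> uniq (layer k j).
Proof.
move=> j48; have /allP/(_ j) := dir_neq0_check; rewrite mem_iota j48 => /(_ isT) d0.
rewrite map_inj_uniq ?iota_uniq // => a b [/addrI E1 /addrI E2].
have [d1|d1] := eqVneq (dir j).1 0.
  have d2 : (dir j).2 != 0.
    by apply: contraNneq d0 => d2; case: (dir j) d1 d2 => ? ? /= -> ->.
  by have /eqP := mulfI d2 E2; rewrite eqz_nat => /eqP.
by have /eqP := mulfI d1 E1; rewrite eqz_nat => /eqP.
Qed.

Lemma shape_round_check :
  all (fun m => bound0 48 m == bound0 0 m + bound1 m) (iota 0 12).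
Proof. by vm_compute. Qed.

Lemma in_shape_round k p : in_shape k 48 p = in_shape k.+1 0 p.
Proof.
apply: eq_in_all => m m12; have /allP/(_ m m12)/eqP -> := shape_round_check.
by congr (_ <= _); rewrite -addn1 PoszD; ring.
Qed.

(** * Neighbours of a newly added point *)

Definition Upm : seq point := Up ++ [seq - u | u <- Up].

Lemma count_sum (T : Type) (P : pred T) (s : seq T) :
  count P s = \sum_(x <- s) (P x : nat).
Proof. by elim: s => [|x s IH]; rewrite ?big_nil // big_cons /= IH. Qed.

Lemma edges_rcons (s : seq point) (p : point) : uniq (rcons s p) ->
  edges (rcons s p) = (edges s + count (fun v => (p + v)%R \in s) Upm)%N.
Proof.
rewrite rcons_uniq => /andP[ps us].
rewrite /Upm count_cat count_map !count_sum /edges -!big_split /=.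
apply: eq_big_seq => u uU.
have u0 : u != 0 by apply: contraTneq uU => ->.
rewrite -cats1 count_cat /= addn0 mem_cat inE -[X in _ == X]addr0 (inj_eq (addrI _)) (negbTE u0) orbF.
suff -> : count (fun x => (x + u)%R \in s ++ [:: p]) s =
    (count (fun x => (x + u)%R \in s) s + ((p - u)%R \in s))%N.
  by rewrite -addnA [X in (_ + X)%N]addnC.
rewrite -(count_uniq_mem _ us) !count_sum -big_split /=.
apply: eq_bigr => x _; rewrite mem_cat inE.
have -> : (x == p - u) = (x + u == p) by rewrite eq_sym subr_eq eq_sym.
by case: eqP => [->|_]; rewrite ?(negbTE ps) // orbF addn0.
Qed.

Definition inner (j : nat) : seq point := [seq v <- Upm | form (side j) v < 0].

(** Of the twelve neighbours of a point on the new side, two lie on its line and five on either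
    side. For k >= 2 the five inner ones are already present; the sixth, at [- dir j], is the
    preceding point of the layer. *)
Lemma inner_check : all (fun j =>
  [&& size (inner j) == 5%N, uniq (- dir j :: inner j),
      all (mem Upm) (- dir j :: inner j) &
      all (fun v => all (fun m => nonneg_on_layer (slack0 j j m v) (slack1 j m)
        (slack2 j m) (extra j) 2) (iota 0 12)) (inner j)]) (iota 0 48).
Proof. by vm_compute. Qed.

Lemma inner_in_shape k j (i : nat) v : (1 < k)%N -> (j < 48)%N ->
  (i < layer_size k j)%N -> v \in inner j -> in_shape k j (layer_point k j i%:Z + v).
Proof.
move=> k2 j48 ik vj; have /allP/(_ j) := inner_check.
rewrite mem_iota j48 => /(_ isT)/and4P[_ _ _ /allP/(_ v vj)/allP H].
apply/in_shapeP => m m12; have := H m; rewrite mem_iota m12 => /(_ isT).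
move=> /nonneg_on_layerP/(_ k2 ik); rewrite -slackE; lia.
Qed.

Lemma neighbours_layer_point (s : seq point) k j (i : nat) :
  (1 < k)%N -> (j < 48)%N -> (i < layer_size k j)%N ->
  {subset in_shape k j <= s} ->
  ((0 < i)%N -> layer_point k j (i%:Z - 1) \in s) ->
  (5 + (0 < i) <= count (fun v => (layer_point k j i%:Z + v)%R \in s) Upm)%N.
Proof.
move=> k2 j48 ik sub prev; have /allP/(_ j) := inner_check.
rewrite mem_iota j48 => /(_ isT)/and4P[/eqP <- uj /allP jU _].
rewrite -size_filter.
have -> : (size (inner j) + (0 < i))%N =
    size (if (0 < i)%N then - dir j :: inner j else inner j).
  by case: posnP; rewrite ?addn0 //= addn1.
apply: uniq_leq_size.
  by case: ifP uj => // _ /andP[].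
move=> v vj; rewrite mem_filter.
have -> : v \in Upm.
  by apply: jU; case: ifP vj => // _ vj; rewrite inE vj orbT.
rewrite andbT.
have inn : v \in inner j -> layer_point k j i%:Z + v \in s.
  by move=> vi; apply: sub; apply: inner_in_shape.
case: ifP vj => [i0|_]; last exact: inn.
rewrite inE => /orP[/eqP ->|]; last exact: inn.
have -> // : layer_point k j i%:Z - dir j = layer_point k j (i%:Z - 1).
  by rewrite /layer_point; congr (_, _) => /=; ring.
by apply: prev; rewrite i0.
Qed.

(** * Optimality of every initial segment *)

Definition deficit_minimal (s : seq point) : Prop :=
  forall B, admissible (size s) B -> (6 * size s <= edges s + B)%N.

Definition prefixes_minimal (s : seq point) : Prop :=
  forall n, (3 <= n <= size s)%N -> deficit_minimal (take n s).

Definition excess (j : nat) : int := (sumn [seq extra i | i <- iota 0 j])%:Z - j%:Z.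

Lemma excessS j : excess j.+1 = excess j + (extra j)%:Z - 1.
Proof.
by rewrite /excess -addn1 iotaD map_cat sumn_cat /= add0n addn0 !PoszD; ring.
Qed.

(** The first inequality is (48 k + j - 24)^2 + 63 < 96 (N + 1), where N is the size at stage (k,
    j); all terms in k cancel. The second keeps N at or above the exceptional number of index k when
    k >= 2. *)
Lemma excess_check : all (fun j : nat =>
  (j%:Z * j%:Z - 48 * j%:Z - 129 < 96 * excess j) && (0 <= 2 * j%:Z + excess j))
  (iota 0 48) && (excess 48 == 0).
Proof. by vm_compute. Qed.

Record stage (k j : nat) (s : seq point) : Prop := Stage {
  stage_uniq : uniq s;
  stage_mem : s =i in_shape k j;
  stage_size : (size s)%:Z =
    24 * (k%:Z * k%:Z) - 24 * k%:Z + 7 + j%:Z * k%:Z + excess j;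
  stage_edges : (6 * size s + 24 <= edges s + (48 * k + j))%N;
  stage_prefixes : prefixes_minimal s
}.

Lemma stage_optimal k j s n B : (1 < k)%N -> (j < 48)%N -> stage k j s ->
  (size s < n)%N -> admissible n B -> (48 * k + j + 1 <= B + 24)%N.
Proof.
move=> k2 j48 st sn adm.
have /andP[/allP/(_ j) + _] := excess_check; rewrite mem_iota j48 => /(_ isT).
have := stage_size st; move: (excess j) => c sE /andP[cj c0].
rewrite leqNgt; apply/negP => Bk.
have kE : exists d, k = (d + 2)%N by exists (k - 2)%N; lia.
case: adm => [|[[l l1 nE] nB]].
  rewrite -mulnn => nB.
  have : (B * B <= (48 * k + j - 24) * (48 * k + j - 24))%N by apply: leq_mul; lia.
  case: kE => d kE; rewrite kE in sE *.
  nia.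
have jk : 2 * j%:Z <= j%:Z * k%:Z by rewrite mulrC ler_wpM2l //; lia.
have nk : 24 * (k%:Z * k%:Z) - 24 * k%:Z + 7 < n%:Z by clear -sE jk c0 sn; lia.
(* An exceptional n past this stage has an index l > k, and then B is at least 48 l - 24, more than
   48 k + j - 24. *)
have kl : (k < l)%N.
  rewrite ltnNge; apply/negP => lk; move: nE nk; rewrite -mulnn; clear -l1 lk; nia.
have : (B * B < (48 * l - 24) * (48 * l - 24))%N by apply: ltn_mul; lia.
move: nB nE; rewrite -!mulnn; clear -l1; nia.
Qed.

Lemma take_layerS k j i : (i < layer_size k j)%N ->
  take i.+1 (layer k j) = rcons (take i (layer k j)) (layer_point k j i%:Z).
Proof.
move=> ik; have sz : size (layer k j) = layer_size k j by rewrite size_map size_iota.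
by rewrite (take_nth 0) ?sz // (nth_map 0%N) ?size_iota // nth_iota.
Qed.

Lemma mem_take_layer k j i h : (i < h <= layer_size k j)%N ->
  layer_point k j i%:Z \in take h (layer k j).
Proof.
move=> /andP[ih hk]; rewrite -map_take take_iota (minn_idPl hk).
by apply/mapP; exists i; rewrite ?mem_iota.
Qed.

Lemma stage_layer k j s i : (1 < k)%N -> (j < 48)%N -> stage k j s ->
  (i <= layer_size k j)%N ->
  uniq (s ++ take i (layer k j)) /\
  (6 * size (s ++ take i (layer k j)) + 24 <=
    edges (s ++ take i (layer k j)) + (48 * k + j + (0 < i)))%N.
Proof.
move=> k2 j48 st; elim: i => [|i IH] ik.
  rewrite take0 cats0; split; first exact: stage_uniq st.
  by rewrite addn0; apply: stage_edges st.
have utr : uniq (s ++ take i.+1 (layer k j)).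
  rewrite cat_uniq (stage_uniq st) take_uniq ?layer_uniq // andbT /=.
  apply/hasPn => p /mem_take pl; rewrite (stage_mem st).
  exact: layer_not_in_shape pl.
split=> //; have [ut et] := IH (ltnW ik); move: utr.
rewrite take_layerS // -rcons_cat => utr; rewrite edges_rcons // size_rcons.
have : (5 + (0 < i) <= count (fun v => (layer_point k j i%:Z + v)%R \in
    s ++ take i (layer k j)) Upm)%N.
  apply: (neighbours_layer_point k2 j48 ik).
    by move=> p ps; rewrite mem_cat (stage_mem st) ps.
  move=> i0; rewrite mem_cat; apply/orP; right.
  have -> : i%:Z - 1 = i.-1%:Z by lia.
  by apply: mem_take_layer; rewrite prednK // leqnn ltnW.
move: et; clear; move: (size _) (edges _) (count _ _) (leqP 1 i) => a b c.
by case=> /=; lia.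
Qed.

(** Along the layer the deficit is at most one above the bound for [s], and by [stage_optimal] no
    smaller value is admissible past [size s]. *)
Lemma stage_next k j s : (1 < k)%N -> (j < 48)%N -> stage k j s ->
  stage k j.+1 (s ++ layer k j).
Proof.
move=> k2 j48 st.
have st_layer i := stage_layer k2 j48 st (i := i).
have szl : size (layer k j) = layer_size k j by rewrite size_map size_iota.
have [u e] := st_layer _ (leqnn _); rewrite take_oversize ?szl // in u e.
split=> //.
- by move=> p; rewrite mem_cat (stage_mem st) [RHS]in_shapeS //; lia.
- have := stage_size st; rewrite size_cat size_map size_iota excessS /layer_size; lia.
- by move: e; case: (0 < _)%N => /=; lia.
move=> n /andP[n3 ns]; rewrite take_cat.
case: ltnP => [nle|nge].
  by apply: (stage_prefixes st); rewrite n3 ltnW.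
have [sn|nsz] := ltnP (size s) n; last first.
  have -> : (n - size s = 0)%N by lia.
  rewrite take0 cats0.
  by have := stage_prefixes st (n := size s); rewrite take_size; apply; lia.
have il : (n - size s <= layer_size k j)%N.
  by move: ns; rewrite size_cat size_map size_iota; lia.
have [_] := st_layer _ il.
move=> E B adm.
have szE : size (s ++ take (n - size s) (layer k j)) = n.
  by rewrite size_cat size_take size_map size_iota; case: ltnP; lia.
have := stage_optimal k2 j48 st sn (B := B); rewrite -szE => /(_ adm).
move: E; rewrite szE; case: (0 < _)%N => /=; lia.
Qed.

Lemma stage_round k s : stage k 48 s -> stage k.+1 0 s.
Proof.
case=> u mem sz e pre; split=> //.
- by move=> p; rewrite mem [RHS]/in_mem /= -in_shape_round.
- have /andP[_ /eqP c48] := excess_check; rewrite sz c48 /excess /=; lia.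
- lia.
Qed.

Definition hexagon : seq point :=
  [:: (0, 0); (1, 0); (0, 1); (-1, 1); (-1, 0); (0, -1); (1, -1)].

Definition layers_before (k j : nat) : seq point :=
  flatten [seq layer k i | i <- iota 0 j].

Lemma layers_beforeS k j : layers_before k j.+1 = layers_before k j ++ layer k j.
Proof. by rewrite /layers_before -addn1 iotaD map_cat flatten_cat /= cats0. Qed.

Fixpoint spiral (K : nat) : seq point :=
  if K is K'.+1 then spiral K' ++ layers_before K.+1 48
  else hexagon ++ layers_before 1 48.

Lemma mem_hexagon : hexagon =i in_shape 1 0.
Proof.
have /allP hex : all (in_shape 1 0) hexagon by vm_compute.
move=> -[x y]; apply/idP/idP => [/hex //|/in_shapeP H].
have := H 0%N isT; have := H 1%N isT; have := H 2%N isT.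
have := H 6%N isT; have := H 7%N isT; have := H 8%N isT.
rewrite /form /bound0 /bound1 /= => {H} h1 h2 h3 h4 h5 h6.
have : x = -1 \/ x = 0 \/ x = 1 by lia.
have : y = -1 \/ y = 0 \/ y = 1 by lia.
by case=> [|[|]] yE [|[|]] xE; rewrite xE yE in h1 h2 h3 h4 h5 h6 *; vm_compute; lia.
Qed.

Lemma edgesE s :
  edges s = sumn [seq count (fun x => (x + u)%R \in s) s | u <- Up].
Proof. by rewrite sumnE big_map. Qed.

(** The deficit d is least if d - 1 is not admissible; 7 and 55 are the exceptional numbers in the
    range 3 to 55. *)
Definition small_check (s : seq point) : bool :=
  all (fun n => let t := take n s in
    let d := (6 * n - sumn [seq count (fun x => (x + u)%R \in t) t | u <- Up])%N in
    ((d.-1 * d.-1 + if (n == 7) || (n == 55) then 96 else 63) < 96 * n)%N)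
   (iota 3 53).

(* In the first round some layers are empty, and the first point of the next
   layer has fewer than five neighbours: hence the check by computation. *)
Lemma stage_spiral0 : stage 2 0 (spiral 0).
Proof.
split.
- by vm_compute.
- move=> p; rewrite -[RHS]in_shape_round.
  suff -> j : (j <= 48)%N -> (p \in hexagon ++ layers_before 1 j) = in_shape 1 j p by [].
  elim: j => [_|j IH j48]; first by rewrite cats0 mem_hexagon.
  by rewrite layers_beforeS catA mem_cat IH 1?ltnW // in_shapeS.
- by vm_compute.
- by rewrite edgesE; vm_compute.
have : size (spiral 0) = 55%N by vm_compute.
have : small_check (spiral 0) by vm_compute.
move: (spiral 0) => s check sz n; rewrite sz => /andP[n3 n55] B; rewrite size_takel ?sz // => adm.
have /allP/(_ n) := check; rewrite mem_iota n3 => /(_ n55).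
cbv beta zeta; rewrite -edgesE; set d := (6 * n - _)%N => dn.
suff : (d <= B)%N by rewrite /d; lia.
rewrite leqNgt; apply/negP => Bd.
have : (B * B <= d.-1 * d.-1)%N by apply: leq_mul; lia.
move: dn adm; clearbody d; rewrite /admissible -mulnn.
case: ifP => [_ ? [|[_]]|n7 dn [|[[k k1 nE] nB]]]; try lia.
have : (k <= 2)%N by rewrite leqNgt; apply/negP => k2; move: nE; rewrite -mulnn; nia.
case: k k1 nE {nB} => [|[|[|k]]] //= _ nE _.
  by have n7E : n = 7%N by [lia]; rewrite n7E in n7.
by have n55E : n = 55%N by [lia]; rewrite n55E in n7.
Qed.

Lemma stage_spiral K : stage K.+2 0 (spiral K).
Proof.
elim: K => [|K IH]; first exact: stage_spiral0.
apply: stage_round => /=.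
suff H j : (j <= 48)%N -> stage K.+2 j (spiral K ++ layers_before K.+2 j) by apply: H.
elim: j => [_|j IHj j48]; first by rewrite cats0.
by rewrite layers_beforeS catA; apply: stage_next => //; apply/IHj/ltnW.
Qed.

Lemma size_spiral K : (K < size (spiral K))%N.
Proof.
have := stage_size (stage_spiral K); have -> : excess 0 = 0 by [].
by move: (size _) => n; nia.
Qed.

Lemma spiral_prefix K L n : (K <= L)%N -> (n < size (spiral K))%N ->
  nth 0 (spiral L) n = nth 0 (spiral K) n.
Proof.
move=> /subnKC <-; elim: (L - K)%N => [|d IH] nK; first by rewrite addn0.
rewrite addnS /= nth_cat IH //; case: ltnP => // le.
suff : (size (spiral K) <= size (spiral (K + d)))%N by lia.
elim: (d) => [|e IHe]; first by rewrite addn0.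
by rewrite addnS /= size_cat; apply: leq_trans (leq_addr _ _).
Qed.

(** The default 0 is never reached: [spiral n] has more than n points. *)
Definition walk (n : nat) : point := nth 0 (spiral n) n.

Lemma walk_take n : [seq walk i | i <- iota 0 n] = take n (spiral n).
Proof.
have sz := size_spiral n.
apply: (@eq_from_nth _ 0); first by rewrite size_map size_iota size_takel // ltnW.
move=> i; rewrite size_map size_iota => lt_in.
rewrite (nth_map 0%N) ?size_iota // nth_iota // nth_take // /walk.
by rewrite (@spiral_prefix i n) ?size_spiral // ltnW.
Qed.

Lemma walk_uniq n : uniq [seq walk i | i <- iota 0 n].
Proof. by rewrite walk_take take_uniq // (stage_uniq (stage_spiral n)). Qed.

Lemma walk_inj : injective walk.
Proof.
move=> i j ij; have := walk_uniq (maxn i j).+1.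
move/(uniqP 0)/(_ i j); rewrite !inE size_map size_iota !ltnS leq_maxl leq_maxr.
move=> /(_ isT isT); rewrite !(nth_map 0%N) ?size_iota ?ltnS ?leq_maxl ?leq_maxr //.
by rewrite !nth_iota ?ltnS ?leq_maxl ?leq_maxr //; apply.
Qed.

Lemma walk_surj p : exists n, walk n = p.
Proof.
have [K pK] : exists K, p \in spiral K.
  case: p => x y; exists (`|x| + `|y|)%N; rewrite (stage_mem (stage_spiral _)).
  apply/in_shapeP => m m12.
  by do 12 (case: m m12 => [|m] m12; first by rewrite /form /bound0 /bound1 /=; lia).
have iK : (index p (spiral K) < size (spiral K))%N by rewrite index_mem.
exists (index p (spiral K)); rewrite /walk.
rewrite -(@spiral_prefix _ (maxn K (index p (spiral K))) _) ?leq_maxr ?size_spiral //.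
by rewrite (@spiral_prefix K) ?leq_maxl // nth_index.
Qed.

Lemma walk_deficit_minimal n : (3 <= n)%N ->
  deficit_minimal [seq walk i | i <- iota 0 n].
Proof.
move=> n3; rewrite walk_take; apply: (stage_prefixes (stage_spiral n)).
by rewrite n3 ltnW // size_spiral.
Qed.

Lemma edges_size1 (p : point) : edges [:: p] = 0%N.
Proof.
rewrite -[[:: p]]/(rcons [::] p) edges_rcons // edgesE count_sum big1 ?addn0 //.
Qed.

Lemma edges_size2 (p q : point) : p != q -> (edges [:: p; q] <= 1)%N.
Proof.
move=> pq; rewrite -[[:: p; q]]/(rcons [:: p] q) edges_rcons; last first.
  by rewrite /= inE pq.
rewrite edges_size1 (eq_count (a2 := pred1 (p - q))) => [|v].
  by rewrite count_uniq_mem // leq_b1.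
by rewrite /= inE eq_sym [q + v]addrC -subr_eq eq_sym.
Qed.

Theorem walk_edges_max n (t : seq point) : uniq t -> size t = n ->
  (edges t <= edges [seq walk i | i <- iota 0 n])%N.
Proof.
move=> ut tn; have [n3|n3] := leqP 3 n.
  have := edges_bound ut; rewrite tn => /(_ n3)[B adm le].
  have := walk_deficit_minimal n3; rewrite /deficit_minimal size_map size_iota.
  by move=> /(_ _ adm); lia.
case: t ut tn => [|p [|q [|r t]]] /=.
- by rewrite edgesE.
- by rewrite edges_size1.
- rewrite inE andbT => pq <-; apply: leq_trans (edges_size2 pq) _.
  by rewrite edgesE walk_take; vm_compute.
- by move=> _ tn; rewrite -tn in n3.
Qed.

(** * Transfer to the plane *)

Definition incidences (V : seq point) (P : point -> point -> bool) (s : seq point) :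
    seq (point * point) :=
  [seq z <- [seq (x, u) | x <- s, u <- V] | P z.1 z.2].

Lemma mem_incidences V P s x u :
  ((x, u) \in incidences V P s) = [&& P x u, x \in s & u \in V].
Proof.
rewrite mem_filter /=; congr (_ && _); apply/allpairsP/andP => [[[y v]]|[xs uV]].
  by move=> /= [ys vV [-> ->]].
by exists (x, u).
Qed.

Lemma incidences_uniq V P s : uniq V -> uniq s -> uniq (incidences V P s).
Proof.
by move=> uV us; apply/filter_uniq/allpairs_uniq => // -[x u] [y v] _ _ [-> ->].
Qed.

Lemma size_incidences V P s :
  size (incidences V P s) = (\sum_(u <- V) count (P^~ u) s)%N.
Proof.
rewrite size_filter count_sum big_allpairs_dep /= exchange_big /=.
by apply: eq_bigr => u _; rewrite count_sum.
Qed.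

Lemma size_edge_incidences s :
  size (incidences Up (fun x u => x + u \in s) s) = edges s.
Proof. by rewrite size_incidences. Qed.

Lemma count_shiftN (s : seq point) u : uniq s ->
  count (fun x => (x - u)%R \in s) s = count (fun x => (x + u)%R \in s) s.
Proof.
move=> us; rewrite -!size_filter -[RHS](size_map (fun x => x + u)).
apply/perm_size/uniq_perm; first exact: filter_uniq.
  by rewrite map_inj_uniq ?filter_uniq // => x y /addIr.
move=> x; rewrite mem_filter; apply/andP/mapP => [[xus xs]|[y]].
  by exists (x - u); rewrite ?mem_filter subrK ?xs ?xus.
by rewrite mem_filter => /andP[yu ys] ->; rewrite addrK.
Qed.

(** The graph is 12-regular, and an edge inside [s] is met from both its ends. *)
Lemma size_boundary_incidences s : uniq s ->
  (size (incidences Upm (fun x u => (x + u)%R \notin s) s) + 2 * edges s = 12 * size s)%N.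
Proof.
move=> us; rewrite size_incidences mul2n -addnn.
have cN : (\sum_(u <- Up) count (fun x => (x - u)%R \in s) s = edges s)%N.
  by apply: eq_bigr => u _; apply: count_shiftN.
have -> : (edges s + edges s =
    \sum_(u <- Upm) count (fun x => (x + u)%R \in s) s)%N.
  by rewrite -{2}cN /Upm big_cat big_map.
rewrite -big_split /= (eq_bigr (fun _ => size s)) => [|u _].
  by rewrite big_const_seq count_predT /= !addnA; lia.
by rewrite addnC; exact: count_predC.
Qed.

Section Plane.
Variable R : realType.

Definition embed (p : point) : plane R := g1 R *~ p.1 + g2 R *~ p.2.

Lemma embedD p q : embed (p + q) = embed p + embed q.
Proof. by rewrite /embed !mulrzDr addrACA. Qed.

Lemma embedN p : embed (- p) = - embed p.
Proof. by rewrite /embed !mulrNz opprD. Qed.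

Lemma embedB p q : embed (p - q) = embed p - embed q.
Proof. by rewrite embedD embedN. Qed.

Lemma embedE p : embed p =
  (p.1%:~R + p.2%:~R / 2, Num.sqrt 3 / 2 * p.2%:~R).
Proof.
rewrite [LHS]surjective_pairing /embed /=.
have fstz (x : plane R) m : (x *~ m).1 = x.1 *~ m by exact: (raddfMz fst).
have sndz (x : plane R) m : (x *~ m).2 = x.2 *~ m by exact: (raddfMz snd).
rewrite !fstz !sndz /= mul0rz add0r; congr (_ + _, _).
  by rewrite div1r -mulrzl.
by rewrite -mulrzr.
Qed.

Lemma embed_inj : injective embed.
Proof.
move=> [a b] [c d]; rewrite !embedE /= => -[E1 E2].
have s3 : Num.sqrt 3 / 2 != 0 :> R by apply: lt0r_neq0; rewrite divr_gt0 ?sqrtr_gt0.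
have /intr_inj bd := mulfI s3 E2; rewrite bd in E1 *.
by have /intr_inj -> := addIr _ E1.
Qed.
Lemma LambdaP x : Lambda R x <-> exists p, x = embed p.
Proof. by split=> [[m [n ->]]|[[m n] ->]]; [exists (m, n) | exists m, n]. Qed.

Lemma Lambda_embed p : Lambda R (embed p).
Proof. by apply/LambdaP; exists p. Qed.

Lemma U_embed : U R =i [seq embed u | u <- Upm].
Proof.
have -> : U R = [seq embed u | u <- [:: (1, 0); - (1, 0); (1, 1); - (1, 1);
    (0, 1); - (0, 1); (-1, 2); - (-1, 2); (-1, 1); - (-1, 1); (-2, 1); - (-2, 1)]].
  rewrite /U [RHS]/= !embedN /embed /= !mulr0z !mulr1z addr0 add0r.
  rewrite ![_ *~ (-1)]mulrNz ![_ *~ (-2)]mulrNz !mulr1z.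
  by rewrite ![- _ + _]addrC.
by apply/perm_mem/perm_map.
Qed.

Lemma mem_U_embed u : (embed u \in U R) = (u \in Upm).
Proof. by rewrite U_embed (mem_map embed_inj). Qed.

(** With directions in [Up] every edge has one code. A boundary edge is coded from its end inside
    the set, with directions in [Upm], again in one way. *)
Definition edge_of (z : point * point) : {fset plane R} :=
  [fset embed z.1; embed (z.1 + z.2)%R]%fset.

Lemma edge_of_eq x u y v : edge_of (x, u) = edge_of (y, v) ->
  x = y /\ u = v \/ x = y + v /\ y = x + u.
Proof.
rewrite /edge_of /= => E.
have mem p : (p == x) || (p == x + u) = (p == y) || (p == y + v).
  have := congr1 (fun A : {fset _} => embed p \in A) E.
  by rewrite /= !in_fset2 !(inj_eq embed_inj).
have [xy|xy] := eqVneq x y; [left; split=> //; subst y|right].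
  have := mem (x + u); rewrite eqxx orbT => /esym/orP[/eqP xu|/eqP/addrI //].
  have := mem (x + v); rewrite eqxx orbT xu orbb => /eqP xv.
  by apply: (addrI x); rewrite xu xv.
have := mem x; rewrite eqxx (negbTE xy) => /esym/eqP xE; split=> //.
by have := mem y; rewrite eqxx eq_sym (negbTE xy) => /eqP.
Qed.

Lemma edge_of_inj_Up x u y v : u \in Up -> v \in Up ->
  edge_of (x, u) = edge_of (y, v) -> (x, u) = (y, v).
Proof.
move=> uU vU /edge_of_eq[[-> ->] //|[xE yE]].
have vu : v = - u by apply: (addrI y); rewrite -xE yE addrK.
have : - u \notin Up by have /allP/(_ u uU) : all (fun w => - w \notin Up) Up by [].
by rewrite -vu vU.
Qed.

Lemma edge_ofC x u : edge_of (x + u, - u) = edge_of (x, u).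
Proof. by rewrite /edge_of /= addrK fsetUC. Qed.

Lemma edge_of_in_Lambda_U x u : u \in Upm -> Lambda_U_edges R (edge_of (x, u)).
Proof.
move=> uU; exists (embed x), (embed (x + u)); split; try exact: Lambda_embed.
  by rewrite -embedB addrC addKr mem_U_embed.
by [].
Qed.

Lemma Lambda_U_edgesP e : Lambda_U_edges R e ->
  exists x u, u \in Up /\ e = edge_of (x, u).
Proof.
case=> _ [_ [/LambdaP[p ->] /LambdaP[q ->]]]; rewrite -embedB mem_U_embed => qpU ->.
have /orP[qp|] : (q - p \in Up) || (p - q \in Up).
  move: qpU; rewrite mem_cat => /orP[-> //|/mapP[u uU E]].
  by rewrite -[p - q]opprB E opprK uU orbT.
  by exists p, (q - p); rewrite /edge_of /= [(p + _)%R]addrC subrK.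
by exists q, (p - q); rewrite /edge_of /= [(q + _)%R]addrC subrK fsetUC.
Qed.

Definition coords (S : {fset plane R}) : seq point :=
  [seq xget 0 [set p | embed p = x] | x <- S].

Lemma coordsK (S : {fset plane R}) : [set` S] `<=` Lambda R ->
  [seq embed p | p <- coords S] = S.
Proof.
move=> SL; rewrite -map_comp -[RHS]map_id; apply/eq_in_map => x xS /=.
have /LambdaP[p xp] : Lambda R x by apply: SL.
exact: (xgetPex 0 (ex_intro (fun p => embed p = x) p (esym xp))).
Qed.

Lemma coords_uniq (S : {fset plane R}) : [set` S] `<=` Lambda R -> uniq (coords S).
Proof. by move=> SL; apply: (@map_uniq _ _ embed); rewrite coordsK ?fset_uniq. Qed.

Lemma size_coords S : size (coords S) = #|` S|%fset.
Proof. by rewrite size_map. Qed.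

Lemma mem_coords (S : {fset plane R}) p : [set` S] `<=` Lambda R ->
  (p \in coords S) = (embed p \in S).
Proof. by move=> SL; rewrite -(mem_map embed_inj) coordsK. Qed.

End Plane.

(** * Subgraphs, edge boundaries and the closed formula *)

Lemma perm_edges (s t : seq point) : perm_eq s t -> edges s = edges t.
Proof.
move=> st; apply: eq_bigr => u _; rewrite (permP st).
by apply: eq_count => x; rewrite (perm_mem st).
Qed.

Section Counting.
Variable R : realType.
Implicit Types (S V : {fset plane R}) (s : seq point).

Definition edge_incidences s := incidences Up (fun x u => x + u \in s) s.

Lemma edge_of_incidences_inj s :
  {in edge_incidences s &, injective (@edge_of R)}.
Proof.
move=> [x u] [y v]; rewrite !mem_incidences => /and3P[_ _ uU] /and3P[_ _ vU].
exact: edge_of_inj_Up.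
Qed.

Lemma subgraph_edges_le V (E : {fset {fset plane R}}) : is_subgraph V E ->
  (#|` E|%fset <= edges (coords V))%N.
Proof.
case=> VL EL EV; rewrite -size_edge_incidences -(size_map (@edge_of R)).
apply: uniq_leq_size (fset_uniq _) _ => e eE.
have [x [u [uU eE2]]] := Lambda_U_edgesP (EL e eE).
apply/mapP; exists (x, u) => //; rewrite mem_incidences uU andbT !mem_coords //.
have /fsubsetP eV := EV e eE.
by rewrite !eV // eE2 /edge_of ?fset21 ?fset22.
Qed.

Lemma induced_subgraph s : uniq s ->
  exists V (E : {fset {fset plane R}}),
    [/\ is_subgraph V E, #|` V|%fset = size s & #|` E|%fset = edges s].
Proof.
move=> us; exists [fset x in [seq embed R p | p <- s]]%fset.
exists [fset e in [seq edge_of R z | z <- edge_incidences s]]%fset.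
have uE : uniq (edge_incidences s) by apply: incidences_uniq.
split.
- split.
  + by move=> x /=; rewrite !inE => /mapP[p _ ->]; apply: Lambda_embed.
  + move=> e /=; rewrite !inE => /mapP[[x u]]; rewrite mem_incidences => /and3P[_ _ uU] ->.
    by apply: edge_of_in_Lambda_U; rewrite mem_cat uU.
  + move=> e; rewrite !inE => /mapP[[x u]]; rewrite mem_incidences => /and3P[xus xs _] ->.
    by apply/fsubsetP => y; rewrite !inE => /orP[] /eqP ->; apply: map_f.
- by rewrite card_fseq undup_id ?size_map // map_inj_uniq //; apply: embed_inj.
- rewrite card_fseq undup_id ?size_map ?size_edge_incidences //.
  by rewrite map_inj_in_uniq //; apply: edge_of_incidences_inj.
Qed.

(** For a fixed number of points, minimizing the boundary thus amounts to maximizing the induced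
    edges. *)
Lemma boundary_size_edges S : [set` S] `<=` Lambda R ->
  (boundary_size S + 2 * edges (coords S) = 12 * #|` S|%fset)%N.
Proof.
move=> SL; have us := coords_uniq SL; set s := coords S in us *.
rewrite -size_coords -/s -(size_boundary_incidences us); congr (_ + _)%N.
set I := incidences _ _ _.
have inj : {in I &, injective (@edge_of R)}.
  move=> [x u] [y v]; rewrite !mem_incidences => /and3P[xu xs uU] /and3P[yv ys vU].
  by move=> /edge_of_eq[[-> ->] //|[xE yE]]; rewrite xE (negbTE yv) in xs.
have uI : uniq I by apply: incidences_uniq.
rewrite /boundary_size.
have -> : edge_boundary S = [set` [fset e in [seq edge_of R z | z <- I]]%fset].
  apply/seteqP; split => e /=; rewrite !inE.
    move=> [/Lambda_U_edgesP[x [u [uU eE]]] [a [b [eE2 aS bS]]]].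
    have ea : a \in e by rewrite eE2 fset21.
    have eb : b \in e by rewrite eE2 fset22.
    rewrite eE !in_fset2 in ea eb.
    have [xS|xS] := boolP (embed R x \in S).
      have bE : b = embed R (x + u).
        by case/orP: eb bS => /eqP -> //; rewrite xS.
      rewrite eE; apply: map_f; rewrite mem_incidences !mem_coords // xS -bE bS /=.
      by rewrite mem_cat uU.
    have aE : a = embed R (x + u).
      by case/orP: ea aS => /eqP -> //; rewrite (negbTE xS).
    rewrite eE -edge_ofC; apply: map_f.
    rewrite mem_incidences addrK !mem_coords // xS -aE aS /=.
    by rewrite mem_cat map_f ?orbT.
  case/mapP=> -[x u]; rewrite mem_incidences => /and3P[xu xs uU] ->.
  split; first exact: edge_of_in_Lambda_U.
  by exists (embed R x), (embed R (x + u)); rewrite -!mem_coords.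
by rewrite set_fsetK card_fseq undup_id ?size_map // map_inj_in_uniq.
Qed.

Lemma exceptionalP n : is_exceptional n <-> exceptional n.
Proof.
by split=> -[k k1 kE]; exists k => //; move: kE; rewrite -?mulnn ?expr2; lia.
Qed.

(** The least b with b^2 >= 96 n - 63 is the square root rounded up, so 6 n - b is the stated floor.
    For exceptional n, 6 n - 6 = (12 k - 6)^2 and b = 48 k - 24. *)
Lemma max_edges_eq n E b : (3 <= n)%N -> (E + b = 6 * n)%N ->
  admissible n b -> (forall B, admissible n B -> (b <= B)%N) ->
  max_edges R n = E%:R.
Proof.
move=> n3 EE adm bmin; rewrite /max_edges.
have ER : E%:R = 6 * n%:R - b%:R :> R.
  by rewrite -[6]/(6%:R) -natrM -EE natrD addrK.
case: asboolP => [/exceptionalP [k k1 nE]|nexc].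
  have bE : b = (48 * k - 24)%N.
    apply/eqP; rewrite eqn_leq bmin /=; last first.
      by right; split; [exists k | rewrite -mulnn; move: nE; rewrite -mulnn; nia].
    have : (96 * n <= b ^ 2 + 96)%N by case: adm => [|[]]; lia.
    move: nE; rewrite -!mulnn; nia.
  have -> : 6 * n%:R - 6 = (12 * k%:R - 6) ^+ 2 :> R.
    have kR : n%:R + 24 * k%:R = 24 * (k%:R * k%:R) + 7 :> R.
      by rewrite -!natrM -!natrD nE mulnn.
    have -> : n%:R = 24 * (k%:R * k%:R) + 7 - 24 * k%:R :> R by rewrite -kR addrK.
    by ring.
  rewrite sqrtr_sqr ger0_norm; last by rewrite subr_ge0 -!natrM ler_nat; lia.
  rewrite ER bE natrB; last by lia.
  by rewrite natrM; lra.
have {adm} adm : (96 * n <= b ^ 2 + 63)%N.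
  by case: adm => // -[/exceptionalP].
suff -> : Num.floor (6 * n%:R - Num.sqrt (96 * n%:R - 63) : R) = E%:Z by [].
set X : R := 96 * n%:R - 63.
have X0 : 0 <= X by rewrite subr_ge0 -!natrM ler_nat; lia.
have sX : Num.sqrt X ^+ 2 = X by rewrite sqr_sqrtr.
have sX0 := sqrtr_ge0 X.
have le_b : Num.sqrt X <= b%:R.
  rewrite -ler_sqr ?nnegrE // sX lerBlDr -natrX -natrM -natrD ler_nat.
  exact: adm.
case: b EE bmin ER adm le_b => [|b] EE bmin ER adm le_b; first by lia.
have lt_b : b%:R < Num.sqrt X.
  rewrite -ltr_sqr ?nnegrE // sX ltrBrDr -natrX -natrM -natrD ltr_nat ltnNge.
  by apply/negP => le; have := bmin b (or_introl le); rewrite ltnn.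
apply: floor_def; rewrite intrD -[E%:Z%:~R]/(E%:R : R) ER -natr1.
by apply/andP; split; [rewrite lerB // natr1 | lra].
Qed.

End Counting.

Theorem theorem2 (R : realType) :
  (forall n : nat, (3 <= n)%N ->
     (exists (V : {fset plane R}) (E : {fset {fset plane R}}),
        [/\ is_subgraph V E, #|` V| = n & (#|` E|)%:R = max_edges R n]) /\
     (forall (V : {fset plane R}) (E : {fset {fset plane R}}),
        is_subgraph V E -> #|` V| = n -> (#|` E|)%:R <= max_edges R n)) /\
  (exists v : nat -> plane R,
     set_bij [set: nat] (Lambda R) v /\
     forall n : nat, (1 <= n)%N ->
       minimizes_boundary n (initial_segment v n)).
Proof.
split=> [n n3|].
  pose s := [seq walk i | i <- iota 0 n].
  have us : uniq s := walk_uniq n.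
  have sn : size s = n by rewrite size_map size_iota.
  have maxE : max_edges R n = (edges s)%:R.
    have := edges_bound us; rewrite sn => /(_ n3)[B adm le].
    have := walk_deficit_minimal n3; rewrite /deficit_minimal -/s sn => dm.
    apply: (max_edges_eq R n3 (b := (6 * n - edges s)%N)).
    - by lia.
    - by apply: admissible_leq adm; lia.
    - by move=> C /dm; lia.
  split.
    have [V [E [VE Vn Es]]] := induced_subgraph R us.
    by exists V, E; split; rewrite ?Vn ?Es ?maxE.
  move=> V E VE Vn; rewrite maxE ler_nat.
  apply: leq_trans (subgraph_edges_le VE) _.
  case: VE => VL _ _; apply: walk_edges_max; first exact: coords_uniq.
  by rewrite size_coords.
exists (fun n => embed R (walk n)); split.
  split.
  - by move=> n _; apply: Lambda_embed.
  - by move=> i j _ _ /embed_inj/walk_inj.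
  - move=> x /LambdaP[p ->]; have [n <-] := walk_surj p.
    by exists n.
move=> n n1.
have segL : [set` initial_segment (fun i => embed R (walk i)) n] `<=` Lambda R.
  by move=> x /imfsetP[i _ ->]; apply: Lambda_embed.
have card : #|` initial_segment (fun i => embed R (walk i)) n| = n.
  rewrite card_imfset /=; last by move=> i j /embed_inj/walk_inj.
  by rewrite undup_id ?size_iota ?iota_uniq.
split=> // S SL Sn.
have eqA := boundary_size_edges segL; have eqS := boundary_size_edges SL.
rewrite card in eqA; rewrite Sn in eqS.
suff : (edges (coords S) <= edges (coords (initial_segment (fun i => embed R (walk i)) n)))%N by lia.
suff -> : edges (coords (initial_segment (fun i => embed R (walk i)) n)) =
    edges [seq walk i | i <- iota 0 n].
  by apply: walk_edges_max; rewrite ?coords_uniq // size_coords.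
apply: perm_edges; apply: uniq_perm (coords_uniq segL) (walk_uniq n) _ => p.
rewrite mem_coords //; apply/imfsetP/mapP => [[i ni /embed_inj ->]|[i ni ->]]; by exists i.
Qed.
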